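(* Let $q\in\mathbb{N}$ be constant. For any $\epsilon<1/6$ there cannot exist a classical polynomial-time reduction from a $\mathsf{QPCP}[q]$ circuit $V_x$ (which is the $\mathsf{QPCP}[q]$ verifier circuit $V$ with the input $x$ hardwired into it) to an $O(q)$-local Hamiltonian $H_x$ such that, given a proof $|\psi\rangle$, $$\left|\Pr[V_x\text{ accepts }|\psi\rangle]-\left(1-\langle\psi|H_x|\psi\rangle\right)\right|\le\epsilon,$$ unless $\mathsf{QCPCP}[q]\subseteq\mathsf{NP}$ (which would imply $\mathsf{BQP}\subseteq\mathsf{NP}$).
   Context: All classes are classes of promise problems. The inequality is required for every proof $|\psi\rangle$. A promise problem $A=(A_{\mathrm{yes}},A_{\mathrm{no}})$ is in $\mathsf{QPCP}[q]$ if there exist $p(n)\le\mathrm{poly}(n)$ and a polynomial-time quantum algorithm $V$ which acts on an input $|x\rangle$ ($|x|=n$) and a polynomial number of ancilla qubits, and takes as additional input a quantum state $|\xi\rangle\in(\mathbb{C}^2)^{\otimes p(n)}$ (the proof) from which it may access at most $q$ qubits, followed by a measurement of the first qubit, accepting only if the outcome is $|1\rangle$, such that: if $x\in A_{\mathrm{yes}}$ there is $|\xi\rangle$ such that $V$ accepts with probability at least $2/3$; if $x\in A_{\mathrm{no}}$ then for all $|\xi\rangle$, $V$ accepts with probability at most $1/3$. $\mathsf{QCPCP}[q]$ is defined in the same way, except that the proof is a classical bit string $y\in\{0,1\}^{p(n)}$ of which $V$ may read at most $q$ bits, non-adaptively. An $\ell$-local Hamiltonian is a Hermitian operator that is a sum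 of (polynomially many, explicitly given) terms each acting non-trivially on at most $\ell$ qubits. *)

(* Defs.v *)
From mathcomp Require Import all_boot all_order all_algebra.
From mathcomp Require Import reals.
From mathcomp Require Import complex.

Set Implicit Arguments.
Unset Strict Implicit.
Unset Printing Implicit Defensive.

Import Order.TTheory GRing.Theory Num.Theory.

Local Open Scope ring_scope.
Local Open Scope complex_scope.

(** * Classical polynomial time

    The machine model is the WHILE language over binary trees (N. Jones,
    "Computability and Complexity from a Programming Perspective"), with the
    cost of an assignment equal to the size of the stored tree.  Because
    stored data is charged by size (no sharing), a run of cost [t] writes at
    most [t] tree nodes, and cost is polynomially equivalent to Turing machine
    time, for functions as well as for decision problems. *)

Inductive tree := Leaf | Node of tree & tree.

Fixpoint tree_size (t : tree) : nat :=
  if t is Node l r then (tree_size l + tree_size r).+1 else 1%N.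

Inductive expr :=
  | Var of nat
  | Nil
  | Cons of expr & expr
  | Hd of expr
  | Tl of expr.

Inductive cmd :=
  | Assign of nat & expr
  | Seq of cmd & cmd
  | If of expr & cmd & cmd
  | While of expr & cmd.

Definition store := nat -> tree.

Definition update (s : store) (x : nat) (v : tree) : store :=
  fun y => if y == x then v else s y.

Definition hd (t : tree) := if t is Node l _ then l else Leaf.
Definition tl (t : tree) := if t is Node _ r then r else Leaf.

Fixpoint eval (s : store) (e : expr) : tree :=
  match e with
  | Var x => s x
  | Nil => Leaf
  | Cons e1 e2 => Node (eval s e1) (eval s e2)
  | Hd e1 => hd (eval s e1)
  | Tl e1 => tl (eval s e1)
  end.

Definition truthy (t : tree) : bool := if t is Leaf then false else true.

(* [exec c s t s']: from store [s], command [c] halts in store [s'], with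
   cost [t]. *)
Inductive exec : cmd -> store -> nat -> store -> Prop :=
  | exec_assign x e s :
      exec (Assign x e) s (tree_size (eval s e)) (update s x (eval s e))
  | exec_seq c1 c2 s1 s2 s3 t1 t2 :
      exec c1 s1 t1 s2 -> exec c2 s2 t2 s3 ->
      exec (Seq c1 c2) s1 (t1 + t2) s3
  | exec_if_true e c1 c2 s s' t :
      truthy (eval s e) -> exec c1 s t s' -> exec (If e c1 c2) s t.+1 s'
  | exec_if_false e c1 c2 s s' t :
      ~~ truthy (eval s e) -> exec c2 s t s' -> exec (If e c1 c2) s t.+1 s'
  | exec_while_false e c s :
      ~~ truthy (eval s e) -> exec (While e c) s 1 s
  | exec_while_true e c s1 s2 s3 t1 t2 :
      truthy (eval s1 e) -> exec c s1 t1 s2 -> exec (While e c) s2 t2 s3 ->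
      exec (While e c) s1 (t1 + t2).+1 s3.

(* Input and output in variable 0; every other variable is initially [Leaf]. *)
Definition computes (c : cmd) (i o : tree) (t : nat) : Prop :=
  exists2 s' : store,
    exec c (fun x => if x == 0%N then i else Leaf) t s' & s' 0%N = o.

(* One program maps [inp i] to [out i] in polynomial time, for every instance
   [i] satisfying the promise [D]. *)
Definition poly_time_on (I : Type) (D : I -> Prop) (inp out : I -> tree) : Prop :=
  exists (c : cmd) (k : nat), forall i : I, D i ->
    exists t : nat, computes c (inp i) (out i) t /\
      (t <= tree_size (inp i) ^ k + k)%N.

Definition poly_time (I : Type) (inp out : I -> tree) : Prop :=
  poly_time_on (fun _ => True) inp out.

Definition enc_seq (T : Type) (enc : T -> tree) (s : seq T) : tree :=
  foldr (fun x t => Node (enc x) t) Leaf s.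

Definition enc_bool (b : bool) : tree := if b then Node Leaf Leaf else Leaf.

Definition enc_bits : bitseq -> tree := enc_seq enc_bool.

Definition enc_unary (n : nat) : tree := enc_seq (fun _ => Leaf) (nseq n tt).

(* Little-endian, least significant bit first. *)
Definition bin_val (s : bitseq) : nat := foldr (fun (b : bool) n => (b + n.*2)%N) 0%N s.

Definition bin_digits (n : nat) : bitseq :=
  [seq odd (n %/ 2 ^ i) | i <- iota 0 (trunc_log 2 n).+1].

Definition enc_bin (n : nat) : tree := enc_bits (bin_digits n).

Definition enc_int (z : int) : tree := Node (enc_bool (z < 0)) (enc_bin `|z|%N).

Definition enc_rat (r : rat) : tree := Node (enc_int (numq r)) (enc_int (denq r)).

(* Wire names are in unary, so the number of wires of a circuit written down in
   polynomial time is automatically polynomial. *)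
Definition enc_wire (n : nat) (i : 'I_n) : tree := enc_unary i.

(** * Promise problems and NP *)

Record promise_problem := PromiseProblem {
  yes_inst : bitseq -> Prop;
  no_inst : bitseq -> Prop;
  promise_disjoint : forall x, yes_inst x -> no_inst x -> False
}.

Definition complexity_class := promise_problem -> Prop.

Definition subclass (C1 C2 : complexity_class) : Prop :=
  forall A, C1 A -> C2 A.

Definition NP : complexity_class := fun A =>
  exists (M : bitseq -> bitseq -> bool) (k : nat),
    [/\ poly_time (fun xy : bitseq * bitseq => Node (enc_bits xy.1) (enc_bits xy.2))
                  (fun xy => enc_bool (M xy.1 xy.2)),
        forall x, yes_inst A x ->
          exists y : bitseq, (size y <= size x ^ k + k)%N /\ M x y
      & forall x, no_inst A x ->
          forall y : bitseq, (size y <= size x ^ k + k)%N -> ~~ M x y].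

(** * Quantum circuits *)

Definition bits (n : nat) := {ffun 'I_n -> bool}.

Definition setb (n : nat) (a : bits n) (i : 'I_n) (b : bool) : bits n :=
  [ffun j : 'I_n => if j == i then b else a j].

(* The universal gate set H, T = diag(1, e^(i pi/4)), CNOT. *)
Inductive ugate (m : nat) :=
  | Had of 'I_m
  | Tgate of 'I_m
  | Cnot of 'I_m & 'I_m.

Definition ugate_wf (m : nat) (g : ugate m) : bool :=
  if g is Cnot c t then c != t else true.

Definition enc_ugate (m : nat) (g : ugate m) : tree :=
  match g with
  | Had w => Node (enc_unary 0) (enc_wire w)
  | Tgate w => Node (enc_unary 1) (enc_wire w)
  | Cnot c t => Node (enc_unary 2) (Node (enc_wire c) (enc_wire t))
  end.

(* The number held by a register, i.e. a list of wires. *)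
Definition register_value (m : nat) (r : seq 'I_m) (a : bits m) : nat :=
  bin_val [seq a w | w <- r].

(* All circuits below have [work.+1] workspace wires: the input occupies the
   first wires, the remaining ones are ancillas initially 0, and the first
   wire is the one measured at the end. *)
Definition init_bits (work : nat) (x : bitseq) : bits work.+1 :=
  [ffun i : 'I_work.+1 => nth false x i].

Section Amplitudes.
Variable R : realType.

Definition abs2 (z : R[i]) : R := complex.Re z ^+ 2 + complex.Im z ^+ 2.

(* State vectors, possibly unnormalised, in the computational basis. *)
Definition state (n : nat) := bits n -> R[i].

Definition basis_state (n : nat) (b : bits n) : state n :=
  fun a => (a == b)%:R.

Definition unit_state (n : nat) (psi : state n) : Prop :=
  \sum_(a : bits n) abs2 (psi a) = 1.

Definition apply_ugate (m : nat) (g : ugate m) (psi : state m) : state m :=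
  match g with
  | Had w => fun a =>
      ((Num.sqrt 2)^-1)%:C *
        (psi (setb a w false) + (-1) ^+ (a w : nat) * psi (setb a w true))
  | Tgate w => fun a =>
      (if a w then (Num.sqrt 2)^-1 +i* (Num.sqrt 2)^-1 else 1) * psi a
  | Cnot c t => fun a => psi (setb a t (a t (+) a c))
  end.

Definition run_ugates (m : nat) (gs : seq (ugate m)) (psi : state m) : state m :=
  foldl (fun phi g => apply_ugate g phi) psi gs.

Definition first_qubit_prob (m : nat) (psi : state m.+1) : R :=
  \sum_(a : bits m.+1 | a ord0) abs2 (psi a).

(* Measuring the wires in [s]: the outcome is a bit vector supported on [s],
   and the corresponding branch is left unnormalised, so that its squared norm
   carries the probability of the outcome. *)
Definition outcome (m : nat) (s : seq 'I_m) (v : bits m) : bool :=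
  [forall i, v i ==> (i \in s)].

Definition project (m : nat) (s : seq 'I_m) (v : bits m) (psi : state m) : state m :=
  fun a => if [forall (i | i \in s), a i == v i] then psi a else 0.

End Amplitudes.

(** * BQP *)

Record bcircuit := BCircuit {
  bc_work : nat;
  bc_gates : seq (ugate bc_work.+1)
}.

Definition enc_bcircuit (C : bcircuit) : tree :=
  Node (enc_unary (bc_work C)) (enc_seq (@enc_ugate _) (bc_gates C)).

Definition bcircuit_wf (n : nat) (C : bcircuit) : bool :=
  (n <= (bc_work C).+1)%N && all (@ugate_wf _) (bc_gates C).

Definition bc_accept (R : realType) (C : bcircuit) (x : bitseq) : R :=
  first_qubit_prob (run_ugates (bc_gates C) (basis_state R (init_bits (bc_work C) x))).

Definition BQP (R : realType) : complexity_class := fun A =>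
  exists C : nat -> bcircuit,
    [/\ poly_time enc_unary (fun n => enc_bcircuit (C n)),
        forall n, bcircuit_wf n (C n),
        forall x, yes_inst A x -> 2 / 3 <= bc_accept R (C (size x)) x
      & forall x, no_inst A x -> bc_accept R (C (size x)) x <= 1 / 3].

(** * QPCP

    Besides unitary gates on its workspace, the verifier may use access gates.
    An access gate measures a register, giving the index of one proof qubit,
    and then interacts with that qubit: [Fetch r t] swaps it with workspace
    wire [t] (after which it can be processed arbitrarily), and [Read r t]
    applies a CNOT from it to [t].  An out-of-range index gives no access.
    Indices may depend on earlier accesses. *)

Inductive qgate (m : nat) :=
  | Unitary of ugate m
  | Fetch of seq 'I_m & 'I_m
  | Read of seq 'I_m & 'I_m.

Definition is_access (m : nat) (g : qgate m) : bool :=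
  if g is Unitary _ then false else true.

Definition qgate_wf (m : nat) (g : qgate m) : bool :=
  if g is Unitary u then ugate_wf u else true.

Record qcircuit := QCircuit {
  qc_work : nat;
  qc_proof : nat;
  qc_gates : seq (qgate qc_work.+1)
}.

Definition enc_qgate (m : nat) (g : qgate m) : tree :=
  match g with
  | Unitary u => Node (enc_unary 0) (enc_ugate u)
  | Fetch r t => Node (enc_unary 1) (Node (enc_seq (@enc_wire m) r) (enc_wire t))
  | Read r t => Node (enc_unary 2) (Node (enc_seq (@enc_wire m) r) (enc_wire t))
  end.

Definition enc_qcircuit (V : qcircuit) : tree :=
  Node (enc_unary (qc_work V))
    (Node (enc_unary (qc_proof V)) (enc_seq (@enc_qgate _) (qc_gates V))).

Definition qcircuit_wf (n : nat) (V : qcircuit) : bool :=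
  (n <= (qc_work V).+1)%N && all (@qgate_wf _) (qc_gates V).

Section QPCP.
Variable R : realType.

(* Joint states of proof (first argument) and workspace (second argument). *)
Definition qstate (p m : nat) := bits p -> state R m.

Definition fetch (p m : nat) (i : option 'I_p) (t : 'I_m) (psi : qstate p m) :
    qstate p m :=
  if i is Some j then fun y a => psi (setb y j (a t)) (setb a t (y j)) else psi.

Definition read (p m : nat) (i : option 'I_p) (t : 'I_m) (psi : qstate p m) :
    qstate p m :=
  if i is Some j then fun y a => psi y (setb a t (a t (+) y j)) else psi.

Fixpoint accept_prob (p m : nat) (gs : seq (qgate m.+1)) (psi : qstate p m.+1) : R :=
  match gs with
  | [::] => \sum_(y : bits p) first_qubit_prob (psi y)
  | Unitary u :: gs' => accept_prob gs' (fun y => apply_ugate u (psi y))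
  | Fetch r t :: gs' =>
      \sum_(v : bits m.+1 | outcome r v)
        accept_prob gs' (fetch (insub (register_value r v)) t
                               (fun y => project r v (psi y)))
  | Read r t :: gs' =>
      \sum_(v : bits m.+1 | outcome r v)
        accept_prob gs' (read (insub (register_value r v)) t
                              (fun y => project r v (psi y)))
  end.

(* The initial state is |x>|0...0> on the workspace, tensored with the proof. *)
Definition qc_accept (V : qcircuit) (x : bitseq) (xi : state R (qc_proof V)) : R :=
  accept_prob (qc_gates V)
    (fun y a => xi y * basis_state R (init_bits (qc_work V) x) a).

Definition QPCP_verifier (q : nat) (V : nat -> qcircuit) (A : promise_problem) : Prop :=
  [/\ poly_time enc_unary (fun n => enc_qcircuit (V n)),
      forall n, qcircuit_wf n (V n) /\
        (count (@is_access _) (qc_gates (V n)) <= q)%N,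
      forall x, yes_inst A x -> exists xi : state R (qc_proof (V (size x))),
        unit_state xi /\ 2 / 3 <= qc_accept x xi
    & forall x, no_inst A x -> forall xi : state R (qc_proof (V (size x))),
        unit_state xi -> qc_accept x xi <= 1 / 3].

Definition QPCP (q : nat) : complexity_class := fun A =>
  exists V, QPCP_verifier q V A.

End QPCP.

(** * QCPCP

    The proof is a bit string [y].  All index registers are measured at once
    and then, for each pair (register, target) in [cc_reads], the proof bit at
    the measured index is XORed into the target wire. *)

Record ccircuit := CCircuit {
  cc_work : nat;
  cc_proof : nat;
  cc_pre : seq (ugate cc_work.+1);
  cc_reads : seq (seq 'I_cc_work.+1 * 'I_cc_work.+1);
  cc_post : seq (ugate cc_work.+1)
}.

Definition enc_ccircuit (V : ccircuit) : tree :=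
  Node (enc_unary (cc_work V))
    (Node (enc_unary (cc_proof V))
      (Node (enc_seq (@enc_ugate _) (cc_pre V))
        (Node (enc_seq (fun rt => Node (enc_seq (@enc_wire _) rt.1) (enc_wire rt.2))
                       (cc_reads V))
              (enc_seq (@enc_ugate _) (cc_post V))))).

Definition index_wires (m : nat) (rs : seq (seq 'I_m * 'I_m)) : seq 'I_m :=
  flatten [seq rt.1 | rt <- rs].

Definition ccircuit_wf (n : nat) (V : ccircuit) : bool :=
  [&& (n <= (cc_work V).+1)%N, all (@ugate_wf _) (cc_pre V),
      all (@ugate_wf _) (cc_post V)
    & all (fun rt => rt.2 \notin index_wires (cc_reads V)) (cc_reads V)].

Definition proof_bit (p : nat) (y : bits p) (i : nat) : bool :=
  if insub i is Some j then y j else false.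

(* [v] holds the measured indices. *)
Definition xor_answers (p m : nat) (y : bits p) (rs : seq (seq 'I_m * 'I_m))
    (v a : bits m) : bits m :=
  foldl (fun b rt => setb b rt.2 (b rt.2 (+) proof_bit y (register_value rt.1 v)))
        a rs.

Section QCPCP.
Variable R : realType.

Definition cc_accept (V : ccircuit) (x : bitseq) (y : bits (cc_proof V)) : R :=
  let s := index_wires (cc_reads V) in
  let psi := run_ugates (cc_pre V) (basis_state R (init_bits (cc_work V) x)) in
  \sum_(v : bits (cc_work V).+1 | outcome s v)
    first_qubit_prob (run_ugates (cc_post V)
      (fun a => project s v psi (xor_answers y (cc_reads V) v a))).

Definition QCPCP_verifier (q : nat) (V : nat -> ccircuit) (A : promise_problem) : Prop :=
  [/\ poly_time enc_unary (fun n => enc_ccircuit (V n)),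
      forall n, ccircuit_wf n (V n) /\ (size (cc_reads (V n)) <= q)%N,
      forall x, yes_inst A x -> exists y : bits (cc_proof (V (size x))),
        2 / 3 <= cc_accept x y
    & forall x, no_inst A x -> forall y : bits (cc_proof (V (size x))),
        cc_accept x y <= 1 / 3].

Definition QCPCP (q : nat) : complexity_class := fun A =>
  exists V, QCPCP_verifier q V A.

End QCPCP.

(** * Local Hamiltonians

    A term is a list of distinct qubits [w_0, ..., w_(k-1)] and a 2^k x 2^k
    matrix of Gaussian rationals (real part, imaginary part) given by rows,
    where [w_j] is bit [j] of the row and column indices. *)

Definition gaussian_rat := (rat * rat)%type.

Record local_term (p : nat) := LocalTerm {
  lt_supp : seq 'I_p;
  lt_rows : seq (seq gaussian_rat)
}.

Definition local_term_wf (p : nat) (h : local_term p) : bool :=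
  [&& uniq (lt_supp h), size (lt_rows h) == (2 ^ size (lt_supp h))%N
    & all (fun row => size row == (2 ^ size (lt_supp h))%N) (lt_rows h)].

Definition hamiltonian (p : nat) := seq (local_term p).

Definition enc_gaussian_rat (z : gaussian_rat) : tree :=
  Node (enc_rat z.1) (enc_rat z.2).

Definition enc_local_term (p : nat) (h : local_term p) : tree :=
  Node (enc_seq (@enc_wire p) (lt_supp h))
       (enc_seq (enc_seq enc_gaussian_rat) (lt_rows h)).

Definition enc_hamiltonian (p : nat) (H : hamiltonian p) : tree :=
  enc_seq (@enc_local_term p) H.

Section Hamiltonian.
Variable R : realType.

Definition gaussian_val (z : gaussian_rat) : R[i] := ratr z.1 +i* ratr z.2.

(* Matrix entries <b| h |b'> on p qubits: [h] acts as the identity outside its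
   support. *)
Definition term_entry (p : nat) (h : local_term p) (b b' : bits p) : R[i] :=
  if [forall (i | i \notin lt_supp h), b i == b' i] then
    gaussian_val (nth (0, 0) (nth [::] (lt_rows h) (register_value (lt_supp h) b))
                      (register_value (lt_supp h) b'))
  else 0.

Definition ham_entry (p : nat) (H : hamiltonian p) (b b' : bits p) : R[i] :=
  \sum_(h <- H) term_entry h b b'.

Definition is_local_hamiltonian (l p : nat) (H : hamiltonian p) : Prop :=
  all (fun h => local_term_wf h && (size (lt_supp h) <= l)%N) H /\
  (forall b b' : bits p, ham_entry H b' b = (ham_entry H b b')^*).

Definition expectation (p : nat) (H : hamiltonian p) (psi : state R p) : R[i] :=
  \sum_(b : bits p) \sum_(b' : bits p) (psi b)^* * ham_entry H b b' * psi b'.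

(** * Reductions from QPCP circuits to local Hamiltonians *)

(* A circuit V_x is the pair of an input x, hardwired on the input wires, and
   the circuit that a QPCP[q] verifier uses for inputs of length |x|. *)
Definition is_QPCP_circuit (q : nat) (Vx : bitseq * qcircuit) : Prop :=
  exists (V : nat -> qcircuit) (A : promise_problem),
    QPCP_verifier R q V A /\ Vx.2 = V (size Vx.1).

Definition is_hamiltonian_reduction (q l : nat) (eps : R)
    (H : forall Vx : bitseq * qcircuit, hamiltonian (qc_proof Vx.2)) : Prop :=
  poly_time_on (is_QPCP_circuit q)
    (fun Vx => Node (enc_bits Vx.1) (enc_qcircuit Vx.2))
    (fun Vx => enc_hamiltonian (H Vx)) /\
  forall Vx, is_QPCP_circuit q Vx ->
    is_local_hamiltonian l (H Vx) /\
    forall psi : state R (qc_proof Vx.2), unit_state psi ->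
      `| (qc_accept Vx.1 psi)%:C - (1 - expectation (H Vx) psi) | <= eps%:C.

End Hamiltonian.

(* Main.v *)
Require Import Defs.
From mathcomp Require Import all_boot all_order all_algebra.
From mathcomp Require Import reals boolp complex.
From mathcomp Require Import ring zify lra.
Import Defs.

Set Implicit Arguments.
Unset Strict Implicit.
Unset Printing Implicit Defensive.

Import Order.TTheory GRing.Theory Num.Theory.

(** Suppose a reduction exists and let [V] be a QCPCP[q] verifier.  Reading a
    classical proof bit is a CNOT controlled by that bit, so [V] is also a
    QPCP[q] verifier: it only measures its proof in the computational basis, and
    a quantum proof [xi] is accepted with the average, over [|xi y|^2], of the
    acceptance probabilities of the classical proofs [y].  For a basis state
    [y] the energy is the diagonal entry [<y|H|y>], a sum of polynomially many
    explicit rational numbers.  It is below [1/3 + eps < 1/2] for a good proof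
    of a yes instance and above [2/3 - eps > 1/2] for every proof of a no
    instance, so [y] is an NP witness: compute [H], add up the entries and
    compare the sum with [1/2].  The implication to BQP holds because a BQP
    circuit is a QCPCP[q] verifier that reads nothing. *)

(** * Polynomial-time functions on trees *)

(** Membership in NP asks for an actual WHILE program, so most of the proof is a small calculus of
    polynomial-time tree functions whose only recursion is a left fold with controlled growth of the
    accumulator. Matrix entries are rationals in binary whose denominators can multiply up to
    exponentially large numbers; hence the sum is kept as an unreduced fraction of bit strings,
    whose lengths grow only additively.

    The quantum side has one obstacle. A QCPCP circuit measures all index registers at once, while a
    QPCP circuit measures one register, reads, and only then measures the next. The two agree
    because read targets are never index wires: a read cannot disturb a register that is still to be
    measured, and reads commute with each other.

    The constant 1/6 is half of the gap between the acceptance probabilities 2/3 and 1/3. *)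

Lemma leq_expr m n k : m <= n -> m ^ k <= n ^ k.
Proof. by case: k => // k le_mn; rewrite leq_exp2r. Qed.

(** The base [(n i).+2] is at least 2, so any constant is below some power and sums and products
    merely raise the exponent. [pboundedP] converts to the form [n ^ k + k] used by [poly_time]. *)
Definition pbounded (I : Type) (n m : I -> nat) : Prop :=
  exists k, forall i, m i <= (n i).+2 ^ k.

Section PolynomialBounds.
Variable I : Type.
Implicit Types n m : I -> nat.

Lemma pbounded_le n m m' :
  pbounded n m -> (forall i, m' i <= m i) -> pbounded n m'.
Proof. by move=> [k Hk] le_m; exists k => i; apply: leq_trans (Hk i). Qed.

Lemma pbounded_refl n : pbounded n n.
Proof. by exists 1 => i; rewrite expn1; lia. Qed.

Lemma pbounded_const n c : pbounded n (fun _ => c).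
Proof.
exists c => i; apply: leq_trans (ltnW (ltn_expl c (ltnSn 1))) _.
exact: leq_expr.
Qed.

Lemma pbounded_add n m m' :
  pbounded n m -> pbounded n m' -> pbounded n (fun i => m i + m' i).
Proof.
move=> [k Hk] [k' Hk']; exists (k + k').+1 => i.
have [Hm Hm'] := (Hk i, Hk' i).
have le1 : (n i).+2 ^ k <= (n i).+2 ^ (k + k') by rewrite leq_exp2l // leq_addr.
have le2 : (n i).+2 ^ k' <= (n i).+2 ^ (k + k') by rewrite leq_exp2l // leq_addl.
by rewrite expnS; nia.
Qed.

Lemma pbounded_mul n m m' :
  pbounded n m -> pbounded n m' -> pbounded n (fun i => m i * m' i).
Proof.
by move=> [k Hk] [k' Hk']; exists (k + k') => i; rewrite expnD leq_mul.
Qed.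

Lemma pbounded_trans n m m' :
  pbounded n m -> pbounded m m' -> pbounded n m'.
Proof.
move=> Hnm [k' Hk'].
have [k Hk] := pbounded_add Hnm (pbounded_const n 2).
exists (k * k') => i; apply: leq_trans (Hk' i) _; rewrite expnM.
by apply: leq_expr; rewrite -addn2.
Qed.

Lemma pboundedP n m :
  pbounded n m <-> exists k, forall i, m i <= n i ^ k + k.
Proof.
split=> [[k Hk]|[k Hk]].
  (* For [n <= 1] the bound is at most [3 ^ k]; for [n >= 2], [n + 2 <= n ^ 2] gives [n ^ k.*2]. *)
  exists (k.*2 + 3 ^ k) => i; apply: leq_trans (Hk i) _.
  have [n_le1|n_gt1] := leqP (n i) 1.
    apply: leq_trans (_ : 3 ^ k <= _); last by lia.
    by apply: leq_expr.
  apply: leq_trans (_ : (n i) ^ k.*2 <= _).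
    rewrite -muln2 mulnC expnM; apply: leq_expr.
    by rewrite -mulnn; nia.
  by rewrite (leq_trans _ (leq_addr _ _)) // leq_exp2l ?leq_addr.
exists k.+1 => i; apply: leq_trans (Hk i) _.
have le1 : n i ^ k <= (n i).+2 ^ k by apply: leq_expr; lia.
have le2 : k < (n i).+2 ^ k by apply: ltn_expl.
by rewrite expnS; nia.
Qed.

End PolynomialBounds.

Lemma pbounded_reindex (I J : Type) (g : J -> I) (n m : I -> nat) :
  pbounded n m -> pbounded (n \o g) (m \o g).
Proof. by move=> [k Hk]; exists k => j /=. Qed.

(** * Running and composing WHILE programs *)

Lemma tree_size_gt0 t : 0 < tree_size t.
Proof. by case: t. Qed.

Lemma tree_size_hd t : tree_size (hd t) <= tree_size t.
Proof. by case: t => //= l r; lia. Qed.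

Lemma tree_size_tl t : tree_size (tl t) <= tree_size t.
Proof. by case: t => //= l r; lia. Qed.

Fixpoint expr_size (e : expr) : nat :=
  match e with
  | Cons e1 e2 => (expr_size e1 + expr_size e2).+1
  | Hd e1 | Tl e1 => expr_size e1
  | _ => 1
  end.

Fixpoint expr_bound (e : expr) : nat :=
  match e with
  | Var x => x.+1
  | Nil => 0
  | Cons e1 e2 => maxn (expr_bound e1) (expr_bound e2)
  | Hd e1 | Tl e1 => expr_bound e1
  end.

Fixpoint cmd_bound (c : cmd) : nat :=
  match c with
  | Assign x e => maxn x.+1 (expr_bound e)
  | Seq c1 c2 => maxn (cmd_bound c1) (cmd_bound c2)
  | If e c1 c2 => maxn (expr_bound e) (maxn (cmd_bound c1) (cmd_bound c2))
  | While e c1 => maxn (expr_bound e) (cmd_bound c1)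
  end.

Definition agree (v : nat) (s s' : store) : Prop := forall x, x < v -> s x = s' x.

Lemma eval_agree v s s' e : expr_bound e <= v -> agree v s s' -> eval s e = eval s' e.
Proof.
move=> + ag; elim: e => [x|//|e1 IH1 e2 IH2|e IH|e IH] /=; first exact: ag.
- by rewrite geq_max => /andP[/IH1-> /IH2->].
- by move=> /IH->.
- by move=> /IH->.
Qed.

(** [computes] starts from a store that is clean everywhere. This transfers a run, at equal cost, to
    any store that agrees on the variables the program mentions, and keeps the others intact for the
    caller. *)
Lemma exec_agree c s t s1 : exec c s t s1 ->
  forall v s', cmd_bound c <= v -> agree v s s' ->
  exists s1', [/\ exec c s' t s1', agree v s1 s1'
                & forall x, v <= x -> s1' x = s' x].
Proof.
elim=> {c s t s1} [x e s|c1 c2 s1 s2 s3 t1 t2 _ IH1 _ IH2|e c1 c2 s s1 t He _ IH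
  |e c1 c2 s s1 t He _ IH|e c s He|e c s1 s2 s3 t1 t2 He _ IH1 _ IH2] v s' /=;
  rewrite ?geq_max => + ag.
- move=> /andP[x_lt /(eval_agree)/(_ ag) Ee]; exists (update s' x (eval s' e)); split.
  + by rewrite Ee; apply: exec_assign.
  + by move=> z z_lt; rewrite /update Ee ag.
  + by move=> z z_ge; rewrite /update; case: eqP => // Ez; lia.
- case/andP=> /IH1 /(_ ag) [s2' [ex1 ag2 fr1]] /IH2 /(_ ag2) [s3' [ex2 ag3 fr2]].
  by exists s3'; split=> // [|x x_ge]; [apply: exec_seq ex1 ex2|rewrite fr2 // fr1].
- case/and3P=> /eval_agree/(_ ag) Ee /IH /(_ ag) [s1' [ex1 ag1 fr1]] _.
  by exists s1'; split=> //; apply: exec_if_true; rewrite -?Ee.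
- case/and3P=> /eval_agree/(_ ag) Ee _ /IH /(_ ag) [s1' [ex1 ag1 fr1]].
  by exists s1'; split=> //; apply: exec_if_false; rewrite -?Ee.
- case/andP=> /eval_agree/(_ ag) Ee _.
  by exists s'; split=> //; apply: exec_while_false; rewrite -Ee.
- case/andP=> Be Bc; have Ee := eval_agree Be ag.
  have [s2' [ex1 ag2 fr1]] := IH1 _ _ Bc ag.
  have [|s3' [ex2 ag3 fr2]] := IH2 _ _ _ ag2; first by rewrite /= geq_max Be.
  exists s3'; split=> // [|x x_ge]; last by rewrite fr2 // fr1.
  by apply: exec_while_true ex1 ex2; rewrite -Ee.
Qed.

(** An assignment pays for the size of the tree it stores, so cost bounds output size. Composition
    relies on this: the second program's cost is polynomial in the first one's output. *)
Lemma exec_tree_size c s t s' : exec c s t s' ->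
  forall x, tree_size (s' x) <= tree_size (s x) + t.
Proof.
elim=> {c s t s'} [y e s|c1 c2 s1 s2 s3 t1 t2 _ IH1 _ IH2|e c1 c2 s s1 t He _ IH
  |e c1 c2 s s1 t He _ IH|e c s He|e c s1 s2 s3 t1 t2 He _ IH1 _ IH2] x.
- by rewrite /update; case: eqP => _; lia.
- by have := IH1 x; have := IH2 x; lia.
- by have := IH x; lia.
- by have := IH x; lia.
- by lia.
- by have := IH1 x; have := IH2 x; lia.
Qed.

Definition runs (c : cmd) (s : store) (B : nat) (Q : store -> Prop) : Prop :=
  exists t s', [/\ exec c s t s', t <= B & Q s'].

Lemma runs_assign x e s B (Q : store -> Prop) :
  tree_size (eval s e) <= B -> Q (update s x (eval s e)) -> runs (Assign x e) s B Q.
Proof.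
by move=> le_B HQ; do 2!eexists; split; [apply: exec_assign|exact: le_B|exact: HQ].
Qed.

Lemma runs_seq c1 c2 s B1 B2 B (Q1 Q : store -> Prop) :
  runs c1 s B1 Q1 -> (forall s', Q1 s' -> runs c2 s' B2 Q) -> B1 + B2 <= B ->
  runs (Seq c1 c2) s B Q.
Proof.
move=> [t1 [s1 [ex1 le1 /[swap]/[apply] [[t2 [s2 [ex2 le2 HQ]]]]]]] le_B.
by exists (t1 + t2), s2; split=> //; [apply: exec_seq ex1 ex2|lia].
Qed.

Lemma runs_if e c1 c2 s B (Q : store -> Prop) :
  runs (if truthy (eval s e) then c1 else c2) s B Q -> runs (If e c1 c2) s B.+1 Q.
Proof.
case: ifPn => He [t [s1 [ex1 le1 HQ]]]; exists t.+1, s1; split=> //.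
- exact: exec_if_true.
- exact: exec_if_false.
Qed.

(* [v] bounds the variables that the program may modify; quantifying over all
   stores lets programs be composed, since scratch variables need not be
   clean. *)
Definition ptime (I : Type) (f g : I -> tree) : Prop :=
  exists (c : cmd) (v : nat) (B : I -> nat),
    [/\ 0 < v, pbounded (fun i => tree_size (f i)) B
      & forall i s, s 0 = f i ->
          runs c s (B i) (fun s' => s' 0 = g i /\ forall x, v <= x -> s' x = s x)].

(** [poly_time] programs expect clean scratch variables, [ptime] programs get arbitrary ones; this
    prologue bridges the two. There is no skip command, so the base case clears variable 1, whence
    the [maxn 1 n] below. *)
Fixpoint reset (n : nat) : cmd :=
  if n is n'.+1 then Seq (reset n') (Assign n Nil) else Assign 1 Nil.

Lemma runs_reset n s :
  runs (reset n) s n.+1 (fun s' =>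
    [/\ s' 0 = s 0, forall x, 0 < x <= n -> s' x = Leaf
      & forall x, maxn 1 n < x -> s' x = s x]).
Proof.
elim: n => [|n IHn] /=.
  apply: runs_assign => //; split=> // x; first by lia.
  by rewrite /update; case: eqP => //; lia.
apply: runs_seq IHn _ (_ : _ + 1 <= _); last by lia.
move=> s' [s0 clean fr]; apply: runs_assign => //; split=> // x x_in.
- by rewrite /update; case: eqP => // /eqP x_ne; apply: clean; lia.
- by rewrite /update; case: eqP => [|_]; [lia|rewrite fr //; lia].
Qed.

(** Since [h] only produces instances inside the promise [D], the promise disappears from the
    conclusion. The Hamiltonian reduction enters the calculus in this way. *)
Lemma ptime_of_poly_time_on (I J : Type) (D : I -> Prop) (f g : I -> tree)
    (h : J -> I) :
  poly_time_on D f g -> (forall j, D (h j)) ->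
  ptime (fun j => f (h j)) (fun j => g (h j)).
Proof.
move=> [c [k Hc]] HD; pose w := (cmd_bound c).+1.
exists (Seq (reset w) c), w.+1, (fun j => w.+1 + (tree_size (f (h j)) ^ k + k)).
split=> //.
  apply: pbounded_add; first exact: pbounded_const.
  by apply/pboundedP; exists k.
move=> j s s0; have [t [[s' ex s'0] le_t]] := Hc (h j) (HD j).
apply: runs_seq (runs_reset w s) _ (leqnn _) => s1 [s10 clean fr].
have ag : agree w (fun x => if x == 0 then f (h j) else Leaf) s1.
  move=> [|x] x_lt /=; first by rewrite s10 s0.
  by rewrite clean //; lia.
have [|s2 [ex2 ag2 fr2]] := exec_agree ex _ ag; first by rewrite /w.
exists t, s2; split=> //; split; first by rewrite -ag2.
by move=> x x_ge; rewrite fr2 ?fr //; lia.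
Qed.

Lemma poly_time_of_ptime (I : Type) (f g : I -> tree) : ptime f g -> poly_time f g.
Proof.
move=> [c [v [B [v_gt0 /pboundedP[k Hk] Hc]]]]; exists c, k => i _.
have [t [s' [ex le_t [s'0 _]]]] := Hc i (fun x => if x == 0 then f i else Leaf) erefl.
by exists t; split; [exists s'|apply: leq_trans (Hk i)].
Qed.

Lemma ptime_reindex (I J : Type) (h : J -> I) (f g : I -> tree) :
  ptime f g -> ptime (fun j => f (h j)) (fun j => g (h j)).
Proof.
move=> [c [v [B [v_gt0 HB Hc]]]]; exists c, v, (B \o h); split=> //.
  exact: pbounded_reindex HB.
by move=> j s; apply: Hc.
Qed.

Lemma ptime_size (I : Type) (f g : I -> tree) :
  ptime f g -> pbounded (fun i => tree_size (f i)) (fun i => tree_size (g i)).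
Proof.
move=> [c [v [B [v_gt0 HB Hc]]]].
apply: pbounded_le (pbounded_add (pbounded_refl _) HB) _ => i /=.
have [t [s' [ex le_t [<- _]]]] := Hc i (fun=> f i) erefl.
by apply: leq_trans (exec_tree_size ex 0) _; rewrite leq_add2l.
Qed.

Lemma ptime_trans (I : Type) (f g h : I -> tree) :
  ptime f g -> ptime g h -> ptime f h.
Proof.
move=> fg [c' [v' [B' [v'_gt0 HB' Hc']]]].
have Hsize := ptime_size fg; case: fg => [c [v [B [v_gt0 HB Hc]]]].
exists (Seq c c'), (maxn v v'), (fun i => B i + B' i); split=> [||i s s0].
- by lia.
- by apply: pbounded_add => //; apply: pbounded_trans Hsize HB'.
- apply: runs_seq (Hc i s s0) _ (leqnn _) => s1 [s10 fr1].
  have [t [s2 [ex le_t [s20 fr2]]]] := Hc' i s1 s10.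
  by exists t, s2; split=> //; split=> // x x_ge; rewrite fr2 ?fr1 //; lia.
Qed.

Lemma tree_size_eval0 e s t :
  expr_bound e <= 1 -> s 0 = t -> tree_size (eval s e) <= expr_size e * tree_size t.
Proof.
move=> + s0; have t_gt0 := tree_size_gt0 t.
elim: e => [x||e1 IH1 e2 IH2|e IH|e IH] /=.
- by case: x => // _; rewrite s0 mul1n.
- by rewrite mul1n.
- by rewrite geq_max => /andP[/IH1 + /IH2]; lia.
- by move=> /IH; have := tree_size_hd (eval s e); lia.
- by move=> /IH; have := tree_size_tl (eval s e); lia.
Qed.

(* [e] is evaluated in the store whose every variable is the input. *)
Lemma ptime_expr (e : expr) (I : Type) (f g : I -> tree) :
  expr_bound e <= 1 -> (forall i, eval (fun=> f i) e = g i) -> ptime f g.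
Proof.
move=> Be Hg; exists (Assign 0 e), 1, (fun i => expr_size e * tree_size (f i)).
split=> // [|i s s0].
  by apply: pbounded_mul; [apply: pbounded_const|apply: pbounded_refl].
have Ee : eval s e = g i.
  by rewrite -Hg; apply: eval_agree Be _ => -[].
apply: runs_assign; first exact: tree_size_eval0.
by split=> // x x_ge; rewrite /update; case: eqP => //; lia.
Qed.

Lemma ptime_id (I : Type) (f : I -> tree) : ptime f f.
Proof. exact: (@ptime_expr (Var 0)). Qed.

Lemma ptime_hd (I : Type) (f g : I -> tree) : ptime f g -> ptime f (fun i => hd (g i)).
Proof. by move=> fg; apply: ptime_trans fg _; apply: (@ptime_expr (Hd (Var 0))). Qed.

Lemma ptime_tl (I : Type) (f g : I -> tree) : ptime f g -> ptime f (fun i => tl (g i)).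
Proof. by move=> fg; apply: ptime_trans fg _; apply: (@ptime_expr (Tl (Var 0))). Qed.

Fixpoint tree_expr (t : tree) : expr :=
  if t is Node l r then Cons (tree_expr l) (tree_expr r) else Nil.

Lemma ptime_const (I : Type) (f : I -> tree) (t : tree) : ptime f (fun=> t).
Proof.
apply: (@ptime_expr (tree_expr t)) => [|i].
  by elim: t => [|l IHl r IHr] //; rewrite [tree_expr _]/= [expr_bound _]/= geq_max IHl.
by elim: t => //= l -> r ->.
Qed.

Lemma ptime_node (I : Type) (f g h : I -> tree) :
  ptime f g -> ptime f h -> ptime f (fun i => Node (g i) (h i)).
Proof.
move=> fg fh; have [Hsg Hsh] := (ptime_size fg, ptime_size fh).
case: fg fh => [c [v [B [v_gt0 HB Hc]]]] [c' [v' [B' [v'_gt0 HB' Hc']]]].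
(* Variables [w] and [w.+1] lie beyond the scratch space of both programs: [w] saves the input for
   the second program, [w.+1] the result of the first. *)
pose w := maxn v v'.
exists (Seq (Assign w (Var 0)) (Seq c (Seq (Assign w.+1 (Var 0))
  (Seq (Assign 0 (Var w)) (Seq c' (Assign 0 (Cons (Var w.+1) (Var 0)))))))), w.+2.
exists (fun i => tree_size (f i) + (B i + (tree_size (g i) + (tree_size (f i) +
  (B' i + (tree_size (g i) + tree_size (h i) + 1)))))).
split=> // [|i s s0].
  by do ?apply: pbounded_add => //; (exact: pbounded_refl || exact: pbounded_const).
apply: runs_seq (@runs_assign _ _ _ (tree_size (f i)) (fun s' =>
  [/\ s' 0 = f i, s' w = f i
  & forall x, w < x -> s' x = s x]) _ _) _ (leqnn _); first by rewrite /= s0.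
  rewrite /update /= eqxx; split=> // [|x x_gt].
    by case: eqP => // _; rewrite s0.
  by case: eqP => //; lia.
move=> s1 [s10 s1w fr1].
apply: runs_seq (Hc i s1 s10) _ (leqnn _) => s2 [s20 fr2].
have s2w : s2 w = f i by rewrite fr2 // /w; lia.
apply: runs_seq (@runs_assign _ _ _ (tree_size (g i)) (fun s' =>
  [/\ s' w.+1 = g i, s' w = f i
  & forall x, w.+1 < x -> s' x = s x]) _ _) _ (leqnn _); first by rewrite /= s20.
  rewrite /update /= eqxx; split=> // [|x x_gt].
    by case: eqP => //; lia.
  by case: eqP => [|_]; [lia|rewrite fr2 ?fr1 //; lia].
move=> s3 [s3w1 s3w fr3].
apply: runs_seq (@runs_assign _ _ _ (tree_size (f i)) (fun s' =>
  [/\ s' w.+1 = g i, s' 0 = f i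
  & forall x, w.+1 < x -> s' x = s x]) _ _) _ (leqnn _); first by rewrite /= s3w.
  rewrite /update /=; split=> // x x_gt.
  by case: eqP => [|_]; [lia|rewrite fr3].
move=> s4 [s4w1 s40 fr4].
apply: runs_seq (Hc' i s4 s40) _ (leqnn _) => s5 [s50 fr5].
have s5w1 : s5 w.+1 = g i by rewrite fr5 // /w; lia.
apply: runs_assign => /=; rewrite s5w1 s50 /=; first by lia.
rewrite /update; split=> // x x_gt.
by case: eqP => [|_]; [lia|rewrite fr5 ?fr4 //; lia].
Qed.

Lemma ptime_if (I : Type) (f : I -> tree) (b : I -> bool) (g h : I -> tree) :
  ptime f (fun i => enc_bool (b i)) -> ptime f g -> ptime f h ->
  ptime f (fun i => if b i then g i else h i).
Proof.
move=> fb fg fh.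
have fbf := ptime_node fb (ptime_id f).
apply: ptime_trans fbf _.
case: fg fh => [c [v [B [v_gt0 HB Hc]]]] [c' [v' [B' [v'_gt0 HB' Hc']]]].
pose w := maxn v v'.
exists (Seq (Assign w (Hd (Var 0))) (Seq (Assign 0 (Tl (Var 0)))
  (If (Var w) c c'))), w.+1.
exists (fun i => 3 + (tree_size (f i) + (B i + B' i).+1)); split=> // [|i s s0].
  apply: (@pbounded_trans _ _ (fun i => tree_size (f i))).
    by apply: pbounded_le (pbounded_refl _) _ => i /=; lia.
  apply: pbounded_add; first exact: pbounded_const.
  apply: pbounded_add; first exact: pbounded_refl.
  apply: (@pbounded_le _ _ (fun i => B i + B' i + 1)); last by move=> i; lia.
  by do ?apply: pbounded_add => //; exact: pbounded_const.
apply: runs_seq (@runs_assign _ _ _ 3 (fun s' => [/\ s' 0 = s 0, s' w = enc_bool (b i)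
  & forall x, w < x -> s' x = s x]) _ _) _ (leqnn _).
- by rewrite /= s0 /=; case: (b i).
- rewrite /update /= s0 eqxx; split=> // [|x x_gt].
    by case: eqP => //; lia.
  by case: eqP => //; lia.
move=> s1 [s10 s1w fr1].
apply: runs_seq (@runs_assign _ _ _ (tree_size (f i)) (fun s' =>
  [/\ s' 0 = f i, s' w = enc_bool (b i)
  & forall x, w < x -> s' x = s x]) _ _) _ (leqnn _).
- by rewrite /= s10 s0 /=.
- rewrite /update /= s10 s0 /=; split=> // [|x x_gt].
    by case: eqP => //; lia.
  by case: eqP => [|_]; [lia|rewrite fr1].
move=> s2 [s20 s2w fr2]; apply: runs_if; rewrite /= s2w.
have [[t [s3 [ex le_t [s30 fr3]]]] [t' [s3' [ex' le_t' [s30' fr3']]]]] := (Hc i s2 s20,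
  Hc' i s2 s20).
case: (b i) => /=.
  exists t, s3; split=> //; first by lia.
  by split=> // x x_gt; rewrite fr3 ?fr2 //; lia.
exists t', s3'; split=> //; first by lia.
by split=> // x x_gt; rewrite fr3' ?fr2 //; lia.
Qed.

Lemma size_le_enc_seq (T : Type) (enc : T -> tree) (l : seq T) :
  size l <= tree_size (enc_seq enc l).
Proof. by elim: l => //= x l IH; lia. Qed.

(** * Loops over lists *)

Section Fold.
Variables (I A T : Type) (encA : A -> tree) (encT : T -> tree).
Variables (f : I -> tree) (a0 : I -> A) (l : I -> seq T) (step : I -> A -> T -> A).

(** Indexing by pairs of an instance and a prefix length makes one exponent bound every intermediate
    accumulator. *)
Definition fold_size_bounded : Prop :=
  pbounded (fun z : I * nat => tree_size (f z.1)) (fun z =>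
    tree_size (encA (foldl (step z.1) (a0 z.1) (take z.2 (l z.1))))).

Lemma ptime_foldl_bounded :
  ptime f (fun i => encA (a0 i)) -> ptime f (fun i => enc_seq encT (l i)) ->
  ptime (fun z : I * A * T => Node (f z.1.1) (Node (encA z.1.2) (encT z.2)))
        (fun z => encA (step z.1.1 z.1.2 z.2)) ->
  fold_size_bounded ->
  ptime f (fun i => encA (foldl (step i) (a0 i) (l i))).
Proof.
move=> fa fl [c [v [Bs [v_gt0 [ks HBs] Hc]]]] [kb Hb].
have fin := ptime_node (ptime_id f) (ptime_node fa fl).
have Hsl := ptime_size fl.
apply: ptime_trans fin _.
(* Beyond the scratch space of [c], variable [v] keeps the input, [v.+1] the accumulator and [v.+2]
   the unread part of the list. *)
pose body := Seq (Assign 0 (Cons (Var v) (Cons (Var v.+1) (Hd (Var v.+2)))))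
  (Seq c (Seq (Assign v.+1 (Var 0)) (Assign v.+2 (Tl (Var v.+2))))).
pose M i := (tree_size (f i)).+2 ^ kb.
pose L i := tree_size (enc_seq encT (l i)).
(* [N i] bounds the input tree handed to one step, [M i] every accumulator and [L i] the list. [W i]
   bounds one iteration: building that tree, running [c], the two assignments, and 1 for the loop
   test. *)
pose N i := tree_size (f i) + M i + L i + 2.
pose W i := N i + (N i).+2 ^ ks + M i + L i + 1.
exists (Seq (Assign v (Hd (Var 0))) (Seq (Assign v.+1 (Hd (Tl (Var 0))))
  (Seq (Assign v.+2 (Tl (Tl (Var 0)))) (Seq (While (Var v.+2) body)
    (Assign 0 (Var v.+1)))))), v.+3.
exists (fun i => tree_size (f i) + (M i + (L i + ((L i * W i + 1) + M i))));
  split=> // [|i s s0].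
  apply: (@pbounded_trans _ _ (fun i => tree_size (f i))).
    by apply: pbounded_le (pbounded_refl _) _ => i /=; lia.
  have HM : pbounded (fun i => tree_size (f i)) M by exists kb.
  have HN : pbounded (fun i => tree_size (f i)) N.
    by do ?apply: pbounded_add => //; (exact: pbounded_refl || exact: pbounded_const).
  have HNk : pbounded (fun i => tree_size (f i)) (fun i => (N i).+2 ^ ks).
    by apply: pbounded_trans HN _; exists ks.
  have HW : pbounded (fun i => tree_size (f i)) W.
    by do ?apply: pbounded_add => //; exact: pbounded_const.
  by do ?[exact: pbounded_refl | exact: pbounded_const | apply: pbounded_mul =>
    // | apply: pbounded_add => //].
apply: runs_seq (@runs_assign _ _ _ (tree_size (f i)) (fun s' =>
  [/\ s' 0 = s 0, s' v = f i
  & forall x, v < x -> s' x = s x]) _ _) _ (leqnn _).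
- by rewrite /= s0 /=.
- rewrite /update /= s0 eqxx; split=> // [|x x_gt]; by case: eqP => //; lia.
move=> s1 [s10 s1v fr1].
have Ha0 : tree_size (encA (a0 i)) <= M i by have := Hb (i, 0); rewrite /= take0.
apply: runs_seq (@runs_assign _ _ _ (M i) (fun s' =>
  [/\ s' 0 = s 0, s' v = f i, s' v.+1 = encA (a0 i)
  & forall x, v.+1 < x -> s' x = s x]) _ _) _ (leqnn _).
- by rewrite /= s10 s0 /=.
- rewrite /update /= s10 s0 eqxx; split=> // [|x x_gt]; case: eqP => [|_] //; try lia.
  by rewrite fr1 //; lia.
move=> s2 [s20 s2v s2v1 fr2].
apply: runs_seq (@runs_assign _ _ _ (L i) (fun s' =>
  [/\ s' v = f i, s' v.+1 = encA (a0 i),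
  s' v.+2 = enc_seq encT (l i) & forall x, v.+2 < x -> s' x = s x]) _ _) _ (leqnn _).
- by rewrite /= s20 s0 /=.
- rewrite /update /= s20 s0 eqxx; split=> // [||x x_gt]; case: eqP => [|_] //; try lia.
  by rewrite fr2 //; lia.
move=> s3 [s3v s3v1 s3v2 fr3].
(* The hypothesis on all prefixes is what survives the induction: prefix [j] of the tail, started
   after one step, is prefix [j.+1] of the whole list. *)
have loop : forall (r : seq T) a s', 
  (forall j, tree_size (encA (foldl (step i) a (take j r))) <= M i) ->
  tree_size (enc_seq encT r) <= L i ->
  s' v = f i -> s' v.+1 = encA a -> s' v.+2 = enc_seq encT r ->
  runs (While (Var v.+2) body) s' (size r * W i + 1) (fun s'' =>
    s'' v.+1 = encA (foldl (step i) a r) /\ forall x, v.+2 < x -> s'' x = s' x).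
  elim=> [|x r IHr] a s' HM HL s'v s'v1 s'v2.
    by exists 1, s'; split=> //; apply: exec_while_false; rewrite /= s'v2.
  have HaM : tree_size (encA a) <= M i by have := HM 0; rewrite take0.
  have Ha'M : tree_size (encA (step i a x)) <= M i by have := HM 1; rewrite /= take0.
  have HxL : (tree_size (encT x) + tree_size (enc_seq encT r)).+1 <= L i by [].
  have step_runs : runs body s' (W i).-1 (fun s'' => [/\ s'' v = f i,
      s'' v.+1 = encA (step i a x), s'' v.+2 = enc_seq encT r
      & forall x, v.+2 < x -> s'' x = s' x]).
    pose inp := Node (f i) (Node (encA a) (encT x)).
    have inp_le : tree_size inp <= N i by rewrite /inp /N /=; lia.
    apply: runs_seq (@runs_assign _ _ _ (N i) (fun s'' => [/\ s'' 0 = inp, s'' v = f i,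
      s'' v.+2 = Node (encT x) (enc_seq encT r) & forall x, v.+2 < x -> s'' x = s' x])
        _ _) _
      (_ : _ + ((N i).+2 ^ ks + (M i + L i)) <= _).
    + by rewrite /= s'v s'v1 s'v2.
    + rewrite /update /= s'v s'v1 s'v2; split=> // [|y y_gt]; case: eqP => [|_] //; lia.
    + move=> s4 [s40 s4v s4v2 fr4].
      have := Hc (i, a, x) s4 s40 => -[t [s5 [ex le_t [/= s50 fr5]]]].
      apply: runs_seq (_ : runs c s4 ((N i).+2 ^ ks) (fun s'' => s'' = s5)) _ (leqnn _).
        exists t, s5; split=> //; apply: leq_trans le_t (leq_trans (HBs _) _).
        exact: leq_expr.
      move=> _ ->.
      apply: runs_seq (@runs_assign _ _ _ (M i) (fun s'' =>
        [/\ s'' v = f i, s'' v.+1 = encA (step i a x),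
         s'' v.+2 = Node (encT x) (enc_seq encT r) & forall x, v.+2 < x -> s'' x = s'
           x]) _ _) _ (leqnn _).
      * by rewrite /= s50.
      * rewrite /update /= s50 eqxx; split=> // [||y y_gt]; case: eqP => [|_] //; try lia.
        - by rewrite fr5.
        - by rewrite fr5 ?s4v2 //; lia.
        - by rewrite fr5 ?fr4 //; lia.
      move=> s6 [s6v s6v1 s6v2 fr6]; apply: runs_assign; rewrite /= s6v2 /=; first by lia.
      rewrite /update eqxx; split=> // [||y y_gt]; case: eqP => [|_] //; try lia.
      by rewrite fr6.
    + by rewrite /W; lia.
  have W_gt0 : 0 < W i by rewrite /W; lia.
  case: step_runs => t [s'' [ex le_t [s''v s''v1 s''v2 fr'']]].
  have [||t' [s3' [ex' le_t' [s3'v1 fr3']]]] := IHr (step i a x) s'' _ _ s''v s''v1 s''v2.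
  - by move=> j; have := HM j.+1.
  - by lia.
  exists (t + t').+1, s3'; split; first by apply: exec_while_true ex ex'; rewrite /= s'v2.
    by rewrite [size _]/= mulSn; lia.
  by split=> // y y_gt; rewrite fr3' // fr''.
apply: runs_seq (loop (l i) (a0 i) s3 _ _ s3v s3v1 s3v2) _ (_ : _ + M i <= _).
- by move=> j; have := Hb (i, j).
- by [].
- move=> s4 [s4v1 fr4].
  have fold_le : tree_size (encA (foldl (step i) (a0 i) (l i))) <= M i.
    by have := Hb (i, size (l i)); rewrite /= take_size.
  apply: runs_assign; rewrite /= s4v1 //.
  split=> // x x_gt; rewrite /update; case: eqP => [|_]; first by lia.
  by rewrite fr4 // fr3.
- by rewrite leq_add2r leq_add2r leq_mul2r size_le_enc_seq orbT.
Qed.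

(* [mu] is a size measure that each step increases by an amount not depending
   on the accumulator; this rules out exponential growth. *)
Lemma ptime_foldl (mu : A -> nat) (C : nat) (G : I -> T -> nat) :
  ptime f (fun i => encA (a0 i)) -> ptime f (fun i => enc_seq encT (l i)) ->
  ptime (fun z : I * A * T => Node (f z.1.1) (Node (encA z.1.2) (encT z.2)))
        (fun z => encA (step z.1.1 z.1.2 z.2)) ->
  (forall a, tree_size (encA a) <= C * (mu a).+1) ->
  (forall a, mu a <= tree_size (encA a)) ->
  pbounded (fun z : I * T => tree_size (f z.1) + tree_size (encT z.2))
           (fun z => G z.1 z.2) ->
  (forall i a x, mu (step i a x) <= mu a + G i x) ->
  ptime f (fun i => encA (foldl (step i) (a0 i) (l i))).
Proof.
move=> fa fl Hstep Hmu mu_le [k HG] mu_step; apply: ptime_foldl_bounded => //.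
have [Hsa Hsl] := (ptime_size fa, ptime_size fl).
pose S i := tree_size (f i) + tree_size (enc_seq encT (l i)).
pose E i := (S i).+2 ^ k.
suff grow i j : mu (foldl (step i) (a0 i) (take j (l i))) <=
    tree_size (encA (a0 i)) + tree_size (enc_seq encT (l i)) * E i.
  apply: (@pbounded_le _ _ (fun z : I * nat => C * (tree_size (encA (a0 z.1)) +
    tree_size (enc_seq encT (l z.1)) * E z.1 + 1))); last first.
    move=> [i j] /=; apply: leq_trans (Hmu _) _.
    by rewrite leq_mul2l addn1 ltnS grow orbT.
  apply: (@pbounded_reindex _ _ fst (fun i => tree_size (f i))
    (fun i => C * (tree_size (encA (a0 i)) + tree_size (enc_seq encT (l i)) * E i + 1))).
  have HE : pbounded (fun i => tree_size (f i)) E.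
    apply: (@pbounded_trans _ _ S); last by exists k.
    by apply: pbounded_add => //; exact: pbounded_refl.
  by do ?[exact: pbounded_const | apply: pbounded_mul => // | apply: pbounded_add => //].
(* [S i] is frozen to a number [s] that bounds input and list together, so the bound on [G] stays
   fixed while the induction shrinks the list. *)
have : tree_size (enc_seq encT (l i)) <= S i by rewrite /S; lia.
have : tree_size (f i) <= S i - tree_size (enc_seq encT (l i)) by rewrite /S; lia.
rewrite /E; move: (S i) => s le_f le_s.
apply: leq_trans (_ : mu (a0 i) + tree_size (enc_seq encT (l i)) * s.+2 ^ k <= _);
  last first.
  by rewrite leq_add2r mu_le.
elim: (l i) (a0 i) j le_f le_s => [|x r IHr] a [|j] le_f le_s //=; do ?by lia.
have /= le_G : G i x <= s.+2 ^ k.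
  apply: leq_trans (HG (i, x)) _; apply: leq_expr => /=.
  by move: le_f le_s => /=; lia.
apply: leq_trans (IHr _ _ _ _) _; do ?by move: le_f le_s => /=; lia.
have := mu_step i a x; have := tree_size_gt0 (encT x).
by move: (tree_size (encT x)) (tree_size _) => u w; nia.
Qed.

End Fold.

(** * Lists and binary arithmetic *)

Lemma eq_ptime (I : Type) (f g g' : I -> tree) :
  g =1 g' -> ptime f g -> ptime f g'.
Proof.
move=> eq_g [c [v [B [v_gt0 HB Hc]]]]; exists c, v, B; split=> // i s.
by rewrite -eq_g; apply: Hc.
Qed.

Lemma ptime_fst (I : Type) (f g h : I -> tree) :
  ptime f (fun i => Node (g i) (h i)) -> ptime f g.
Proof. exact: ptime_hd. Qed.

Lemma ptime_snd (I : Type) (f g h : I -> tree) :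
  ptime f (fun i => Node (g i) (h i)) -> ptime f h.
Proof. exact: ptime_tl. Qed.

Lemma ptime_truthy (I : Type) (f g : I -> tree) :
  ptime f g -> ptime f (fun i => enc_bool (truthy (g i))).
Proof.
move=> fg; apply: ptime_trans fg _.
exists (If (Var 0) (Assign 0 (Cons Nil Nil)) (Assign 0 Nil)), 1, (fun=> 4).
split=> // [|i s s0]; first exact: pbounded_const.
apply: runs_if; rewrite /= s0; case: (truthy _); apply: runs_assign => //;
  by split=> // x x_ge; rewrite /update; case: eqP => //; lia.
Qed.

Lemma ptime_if_bool (I : Type) (f : I -> tree) (b c d : I -> bool) :
  ptime f (fun i => enc_bool (b i)) -> ptime f (fun i => enc_bool (c i)) ->
  ptime f (fun i => enc_bool (d i)) ->
  ptime f (fun i => enc_bool (if b i then c i else d i)).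
Proof.
move=> fb fc fd; apply: eq_ptime (ptime_if fb fc fd) => i.
by case: (b i).
Qed.

Lemma ptime_negb (I : Type) (f : I -> tree) (b : I -> bool) :
  ptime f (fun i => enc_bool (b i)) -> ptime f (fun i => enc_bool (~~ b i)).
Proof.
move=> fb; apply: eq_ptime (ptime_if_bool fb (ptime_const _ (enc_bool false))
  (ptime_const _ (enc_bool true))) => i.
by case: (b i).
Qed.

Lemma ptime_addb (I : Type) (f : I -> tree) (b c : I -> bool) :
  ptime f (fun i => enc_bool (b i)) -> ptime f (fun i => enc_bool (c i)) ->
  ptime f (fun i => enc_bool (b i (+) c i)).
Proof.
move=> fb fc; apply: eq_ptime (ptime_if_bool fb (ptime_negb fc) fc) => i.
by case: (b i).
Qed.

Section Sequences.
Variables (I T : Type) (enc : T -> tree) (f : I -> tree).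
Implicit Type l : I -> seq T.

Lemma ptime_cons (x : I -> T) l :
  ptime f (fun i => enc (x i)) -> ptime f (fun i => enc_seq enc (l i)) ->
  ptime f (fun i => enc_seq enc (x i :: l i)).
Proof. exact: ptime_node. Qed.

Lemma ptime_behead l :
  ptime f (fun i => enc_seq enc (l i)) ->
  ptime f (fun i => enc_seq enc (behead (l i))).
Proof. by move=> /ptime_tl; apply: eq_ptime => i; case: (l i). Qed.

Lemma ptime_head (d : T) l :
  ptime f (fun i => enc_seq enc (l i)) -> ptime f (fun i => enc (head d (l i))).
Proof.
move=> fl; apply: eq_ptime (ptime_if (ptime_truthy fl) (ptime_hd fl)
  (ptime_const f (enc d))) => i.
by case: (l i).
Qed.

Lemma ptime_foldl_add (A : Type) (encA : A -> tree) (a0 : I -> A) l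
    (step : I -> A -> T -> A) (G : I -> T -> nat) :
  ptime f (fun i => encA (a0 i)) -> ptime f (fun i => enc_seq enc (l i)) ->
  ptime (fun z : I * A * T => Node (f z.1.1) (Node (encA z.1.2) (enc z.2)))
        (fun z => encA (step z.1.1 z.1.2 z.2)) ->
  pbounded (fun z : I * T => tree_size (f z.1) + tree_size (enc z.2))
           (fun z => G z.1 z.2) ->
  (forall i a x, tree_size (encA (step i a x)) <= tree_size (encA a) + G i x) ->
  ptime f (fun i => encA (foldl (step i) (a0 i) (l i))).
Proof.
move=> fa fl fstep HG Hstep.
by apply: (ptime_foldl (mu := fun a => tree_size (encA a))
  (C := 1)) fstep _ _ HG Hstep => // a; lia.
Qed.

End Sequences.

Section SequenceOperations.
Variables (I T : Type) (enc : T -> tree) (f : I -> tree).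
Implicit Type l : I -> seq T.

Lemma foldl_cons_rev (l1 l2 : seq T) :
  foldl (fun a x => x :: a) l2 (rev l1) = l1 ++ l2.
Proof. by rewrite foldl_rev; elim: l1 => //= x l1 ->. Qed.

Lemma ptime_catrev l1 l2 :
  ptime f (fun i => enc_seq enc (l1 i)) -> ptime f (fun i => enc_seq enc (l2 i)) ->
  ptime f (fun i => enc_seq enc (rev (l1 i) ++ l2 i)).
Proof.
move=> fl1 fl2; apply: (@eq_ptime _ _ (fun i => enc_seq enc
    (foldl (fun a x => x :: a) (l2 i) (l1 i)))) => [i|].
  by rewrite -foldl_cons_rev revK.
apply: (ptime_foldl_add (step := fun _ a x => x :: a) (G := fun _ x =>
  (tree_size (enc x)).+1) fl2 fl1).
- apply: (ptime_cons (x := fun z => z.2) (l := fun z => z.1.2)).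
    exact: (@ptime_expr (Tl (Tl (Var 0)))).
  exact: (@ptime_expr (Hd (Tl (Var 0)))).
- by exists 1 => i /=; rewrite expn1; lia.
- by move=> i a x /=; lia.
Qed.

Lemma ptime_rev l :
  ptime f (fun i => enc_seq enc (l i)) -> ptime f (fun i => enc_seq enc (rev (l i))).
Proof.
move=> fl; apply: eq_ptime (ptime_catrev fl (ptime_const _ Leaf :
  ptime f (fun=> enc_seq enc [::]))) => i.
by rewrite cats0.
Qed.

Lemma ptime_cat l1 l2 :
  ptime f (fun i => enc_seq enc (l1 i)) -> ptime f (fun i => enc_seq enc (l2 i)) ->
  ptime f (fun i => enc_seq enc (l1 i ++ l2 i)).
Proof.
move=> /ptime_rev fl1 /(ptime_catrev fl1).
by apply: eq_ptime => i; rewrite revK.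
Qed.

Lemma ptime_map (T' : Type) (enc' : T' -> tree) (g : I -> T -> T') l :
  ptime (fun z : I * T => Node (f z.1) (enc z.2)) (fun z => enc' (g z.1 z.2)) ->
  ptime f (fun i => enc_seq enc (l i)) ->
  ptime f (fun i => enc_seq enc' [seq g i x | x <- l i]).
Proof.
move=> fg fl.
have : ptime f (fun i => enc_seq enc' (foldl (fun a x => g i x :: a) [::] (rev (l i)))).
  apply: (ptime_foldl_add (step := fun i a x => g i x :: a)
      (G := fun i x => (tree_size (enc' (g i x))).+1) _ (ptime_rev fl)).
  - exact: (ptime_const f Leaf).
  - apply: (ptime_cons (x := fun z => g z.1.1 z.2) (l := fun z => z.1.2));
    last exact: (@ptime_expr (Hd (Tl (Var 0)))).
    apply: ptime_trans (ptime_reindex (fun z : I * seq T' * T => (z.1.1, z.2)) fg).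
    exact: (@ptime_expr (Cons (Hd (Var 0)) (Tl (Tl (Var 0))))).
  - apply: (@pbounded_le _ _ (fun z => tree_size (enc' (g z.1 z.2)) + 1));
    last by move=> z; lia.
    apply: pbounded_add; last exact: pbounded_const.
    apply: pbounded_trans (ptime_size fg).
    by exists 1 => z /=; rewrite expn1; lia.
  - by move=> i a x /=; lia.
apply: eq_ptime => i; congr enc_seq.
by rewrite foldl_rev; elim: (l i) => //= x r ->.
Qed.

Lemma ptime_drop (n : I -> nat) l :
  ptime f (fun i => enc_unary (n i)) -> ptime f (fun i => enc_seq enc (l i)) ->
  ptime f (fun i => enc_seq enc (drop (n i) (l i))).
Proof.
move=> fn fl.
apply: (@eq_ptime _ _ (fun i => enc_seq enc (foldl (fun a _ => behead a) (l i)
  (nseq (n i) tt)))) => [i|].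
  congr enc_seq; elim: (n i) (l i) => [|k IHk] r /=; first by rewrite drop0.
  by rewrite IHk -drop1 drop_drop addn1.
apply: (ptime_foldl_bounded (step := fun _ a _ => behead a) fl fn).
- by apply: ptime_behead; exact: (@ptime_expr (Hd (Tl (Var 0)))).
- apply: (@pbounded_le _ _ (fun z => tree_size (enc_seq enc (l z.1)))).
    exact: (@pbounded_reindex _ _ fst (fun i => tree_size (f i))) (ptime_size fl).
  move=> [i j] /=; elim: (take _ _) (l i) => [|_ s IHs] r //=.
  by apply: leq_trans (IHs _) _; case: r => //= x r; lia.
Qed.

Lemma ptime_nth_unary (d : T) (n : I -> nat) l :
  ptime f (fun i => enc_unary (n i)) -> ptime f (fun i => enc_seq enc (l i)) ->
  ptime f (fun i => enc (nth d (l i) (n i))).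
Proof.
move=> fn fl; apply: eq_ptime (ptime_head d (ptime_drop fn fl)) => i.
by rewrite -nth0 nth_drop addn0.
Qed.

End SequenceOperations.

Lemma ptime_unary_size (I T : Type) (enc : T -> tree) (f : I -> tree) (l : I -> seq T) :
  ptime f (fun i => enc_seq enc (l i)) -> ptime f (fun i => enc_unary (size (l i))).
Proof.
move=> fl; have := ptime_map (enc' := fun=> Leaf) (g := fun _ _ => tt)
  (ptime_const _ Leaf) fl.
by apply: eq_ptime => i; rewrite /enc_unary; elim: (l i) => //= x r ->.
Qed.

Fixpoint evens (T : Type) (l : seq T) : seq T :=
  match l with
  | [::] => [::]
  | [:: x] => [:: x]
  | [:: x, _ & l'] => x :: evens l'
  end.

Lemma nth_evens (T : Type) (d : T) (l : seq T) n : nth d (evens l) n = nth d l n.*2.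
Proof.
have [k] := ubnP (size l); elim: k l n => // k IHk [|x [|y l]] n /= size_l.
- by rewrite !nth_nil.
- by case: n => //= n; rewrite !nth_nil.
- by case: n => //= n; rewrite IHk //; lia.
Qed.

(** [evens] consumes two elements at a time; a parity flag turns it into a left fold, with the
    output reversed. *)
Definition evens_step (T : Type) (st : bool * seq T) (x : T) : bool * seq T :=
  (~~ st.1, if st.1 then st.2 else x :: st.2).

Lemma foldl_evens (T : Type) (l s : seq T) :
  (foldl (@evens_step T) (false, s) l).2 = rev (evens l) ++ s.
Proof.
have [k] := ubnP (size l); elim: k l s => // k IHk [|x [|y l]] s //= size_l.
by rewrite {2}/evens_step /= IHk ?rev_cons ?cat_rcons //; lia.
Qed.

Definition enc_pair (A B : Type) (encA : A -> tree) (encB : B -> tree) (p : A * B) :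
  tree :=
  Node (encA p.1) (encB p.2).

Lemma tree_size_enc_bool b : tree_size (enc_bool b) <= 3.
Proof. by case: b. Qed.

Lemma ptime_evens (I T : Type) (enc : T -> tree) (f : I -> tree) (l : I -> seq T) :
  ptime f (fun i => enc_seq enc (l i)) -> ptime f (fun i => enc_seq enc (evens (l i))).
Proof.
move=> fl; pose encA := enc_pair enc_bool (enc_seq enc).
suff /ptime_snd/ptime_rev : ptime f (fun i => encA (foldl (@evens_step T)
  (false, [::]) (l i))).
  by apply: eq_ptime => i; rewrite foldl_evens cats0 revK.
apply: (ptime_foldl_add (step := fun _ => @evens_step T) (G := fun _ x =>
  tree_size (enc x) + 3) _ fl).
- exact: (ptime_const f (Node Leaf Leaf)).
- have fb : ptime (fun z : I * (bool * seq T) * T => Node (f z.1.1) (Node (encA z.1.2)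
  (enc z.2)))
              (fun z => enc_bool z.1.2.1) by exact: (@ptime_expr (Hd (Hd (Tl (Var 0))))).
  have fs : ptime (fun z : I * (bool * seq T) * T => Node (f z.1.1) (Node (encA z.1.2)
    (enc z.2)))
              (fun z => enc_seq enc z.1.2.2) by exact: (@ptime_expr (Tl (Hd (Tl (Var
                0))))).
  apply: ptime_node; first exact: ptime_negb.
  apply: (@eq_ptime _ _ (fun z => if z.1.2.1 then enc_seq enc z.1.2.2 else enc_seq enc
    (z.2 :: z.1.2.2))).
    by move=> z /=; case: (z.1.2.1).
  apply: ptime_if => //; apply: ptime_cons => //.
  exact: (@ptime_expr (Tl (Tl (Var 0)))).
- by apply: pbounded_add; [exists 1 => i /=; rewrite expn1; lia|exact: pbounded_const].
- by move=> i [b s] x; case: b => /=; lia.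
Qed.

Lemma bin_val_cons b s : bin_val (b :: s) = b + (bin_val s).*2.
Proof. by []. Qed.

(** Position [b + 2n] of a list is position [n] among the even positions, once the head is dropped
    when [b] is set. Looking up a binary index this way only shrinks the list, whereas expanding an
    index in unary could take exponential time. *)
Definition descend_step (T : Type) (l : seq T) (b : bool) : seq T :=
  evens (if b then behead l else l).

Lemma head_descend (T : Type) (d : T) (l : seq T) (s : bitseq) :
  head d (foldl (@descend_step T) l s) = nth d l (bin_val s).
Proof.
elim: s l => [|b s IHs] l /=; first by rewrite nth0.
by rewrite IHs /descend_step nth_evens; case: b; rewrite //= nth_behead.
Qed.

Lemma tree_size_evens (T : Type) (enc : T -> tree) (l : seq T) :
  tree_size (enc_seq enc (evens l)) <= tree_size (enc_seq enc l).
Proof.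
have [k] := ubnP (size l); elim: k l => // k IHk [|x [|y l]] //= size_l.
have := IHk l; lia.
Qed.

Lemma ptime_nth_bits (I T : Type) (enc : T -> tree) (d : T) (f : I -> tree)
    (l : I -> seq T) (s : I -> bitseq) :
  ptime f (fun i => enc_bits (s i)) -> ptime f (fun i => enc_seq enc (l i)) ->
  ptime f (fun i => enc (nth d (l i) (bin_val (s i)))).
Proof.
move=> fs fl.
suff : ptime f (fun i => enc_seq enc (foldl (@descend_step T) (l i) (s i))).
  by move=> /(ptime_head d); apply: eq_ptime => i; rewrite head_descend.
apply: (ptime_foldl_add (step := fun _ => @descend_step T) (G := fun _ _ => 0) fl fs).
- apply: ptime_evens.
  apply: (@eq_ptime _ _ (fun z => if z.2 then enc_seq enc (behead z.1.2) else enc_seq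
    enc z.1.2)).
    by move=> z /=; case: (z.2).
  apply: ptime_if; first exact: (@ptime_expr (Tl (Tl (Var 0)))).
    by apply: ptime_behead; exact: (@ptime_expr (Hd (Tl (Var 0)))).
  exact: (@ptime_expr (Hd (Tl (Var 0)))).
- exact: pbounded_const.
- move=> i a x; rewrite addn0; apply: leq_trans (tree_size_evens _ _) _.
  by case: x => //; case: a => //= u a; lia.
Qed.

(** * Arithmetic on little-endian bit strings *)

Lemma tree_size_enc_bits s : size s <= tree_size (enc_bits s) <= 4 * (size s).+1.
Proof. by elim: s => //= b s IHs; have := tree_size_enc_bool b; lia. Qed.

(* The state holds the unread bits of the second summand, the carry, and the
   bits of the sum computed so far, most significant first. *)
Definition sum_step (st : bitseq * bool * bitseq) (x : bool) : bitseq * bool * bitseq :=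
  let y := head false st.1.1 in
  (behead st.1.1, if x (+) y then st.1.2 else x, (x (+) y (+) st.1.2) :: st.2).

(** The first pass ends when [a] is exhausted; the second ripples the carry through the rest of [b]
    against an empty summand, and the last carry becomes the top bit. *)
Definition bits_sum (a b : bitseq) : bitseq :=
  let st := foldl sum_step (b, false, [::]) a in
  let st' := foldl sum_step ([::], st.1.2, st.2) st.1.1 in
  rev (st'.1.2 :: st'.2).

Lemma bin_val_rcons s b : bin_val (rcons s b) = bin_val s + b * 2 ^ size s.
Proof.
elim: s => [|c s IHs]; first by rewrite /= muln1 addn0.
by rewrite rcons_cons !bin_val_cons IHs /= expnS; lia.
Qed.

(** Loop invariant of ripple-carry addition: the output written so far plus the carry and unread
    bits, shifted by the output length, is conserved. *)
Lemma foldl_sum_step st a :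
  let st' := foldl sum_step st a in
  bin_val (rev st'.2) + 2 ^ size st'.2 * (st'.1.2 + bin_val st'.1.1) =
  bin_val (rev st.2) + 2 ^ size st.2 * (st.1.2 + bin_val st.1.1 + bin_val a).
Proof.
elim: a st => [|x a IHa] [[b c] o]; first by rewrite /= addn0.
have /= -> := IHa (sum_step (b, c, o) x).
rewrite rev_cons bin_val_rcons size_rev expnS.
case: b => [|y b]; rewrite ?[head _ _]/= ?[behead _]/= ?bin_val_cons.
  by case: x; case: c => /=; nia.
by case: x; case: y; case: c => /=; nia.
Qed.

Lemma foldl_sum_step_rest st a : (foldl sum_step st a).1.1 = drop (size a) st.1.1.
Proof.
elim: a st => [|x a IHa] [[b c] o]; first by rewrite /= drop0.
by rewrite /= IHa /= -drop1 drop_drop addn1.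
Qed.

Lemma size_foldl_sum_step st a : size (foldl sum_step st a).2 = size st.2 + size a.
Proof. by elim: a st => [|x a IHa] st /=; rewrite ?addn0 ?IHa //=; lia. Qed.

Lemma bin_val_bits_sum a b : bin_val (bits_sum a b) = bin_val a + bin_val b.
Proof.
rewrite /bits_sum; set st := foldl _ _ a; set st' := foldl _ _ _.
have /= := foldl_sum_step (b, false, [::]) a; rewrite -/st.
have /= := foldl_sum_step ([::], st.1.2, st.2) st.1.1; rewrite -/st'.
have -> : st'.1.1 = [::] by rewrite foldl_sum_step_rest.
rewrite rev_cons bin_val_rcons size_rev /=; nia.
Qed.

Lemma size_bits_sum a b : size (bits_sum a b) = (maxn (size a) (size b)).+1.
Proof.
rewrite /bits_sum size_rev /= !size_foldl_sum_step foldl_sum_step_rest /= size_drop.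
by lia.
Qed.

Section Arithmetic.
Variables (I : Type) (f : I -> tree).
Implicit Types a b : I -> bitseq.

Let enc_state := enc_pair (enc_pair enc_bits enc_bool) enc_bits.

Lemma ptime_sum_step (st : I -> bitseq * bool * bitseq) a :
  ptime f (fun i => enc_state (st i)) -> ptime f (fun i => enc_bits (a i)) ->
  ptime f (fun i => enc_state (foldl sum_step (st i) (a i))).
Proof.
move=> fst fa.
(* Each step drops at most one unread bit and writes one, so the total length grows by at most 1.
   The factor 20 is generous: [n] bits are encoded by at most [4 * n.+1] nodes. *)
apply: (ptime_foldl (step := fun _ => sum_step) (G := fun _ _ => 1) (C := 20)
  (mu := fun st => size st.1.1 + size st.2) fst fa).
- pose F (z : I * (bitseq * bool * bitseq) * bool) :=
    Node (f z.1.1) (Node (enc_state z.1.2) (enc_bool z.2)).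
  have fb : ptime F (fun z => enc_bits z.1.2.1.1) by exact: (@ptime_expr (Hd (Hd (Hd
    (Tl (Var 0)))))).
  have fc : ptime F (fun z => enc_bool z.1.2.1.2) by exact: (@ptime_expr (Tl (Hd (Hd
    (Tl (Var 0)))))).
  have fo : ptime F (fun z => enc_bits z.1.2.2) by exact: (@ptime_expr (Tl (Hd (Tl (Var
    0))))).
  have fx : ptime F (fun z => enc_bool z.2) by exact: (@ptime_expr (Tl (Tl (Var 0)))).
  have fxy := ptime_addb fx (ptime_head false fb).
  apply: ptime_node; last by apply: ptime_cons => //; exact: ptime_addb.
  by apply: ptime_node; [exact: ptime_behead|exact: ptime_if_bool].
- move=> [[b c] o]; have := tree_size_enc_bits b; have := tree_size_enc_bits o.
  by have := tree_size_enc_bool c; rewrite /=; lia.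
- move=> [[b c] o]; have := tree_size_enc_bits b; have := tree_size_enc_bits o.
  by rewrite /=; lia.
- exact: pbounded_const.
- by move=> i [[b c] o] x /=; rewrite size_behead; lia.
Qed.

Lemma ptime_bits_sum a b :
  ptime f (fun i => enc_bits (a i)) -> ptime f (fun i => enc_bits (b i)) ->
  ptime f (fun i => enc_bits (bits_sum (a i) (b i))).
Proof.
move=> fa fb; have fnil := ptime_const f Leaf.
have f1 := ptime_sum_step (st := fun i => (b i, false, [::]))
  (ptime_node (ptime_node fb fnil) fnil) fa.
have f2 := ptime_sum_step (st := fun i => ([::], _, _))
  (ptime_node (ptime_node fnil (ptime_snd (ptime_fst f1))) (ptime_snd f1))
  (ptime_fst (ptime_fst f1)).
exact: ptime_rev (ptime_cons (ptime_snd (ptime_fst f2)) (ptime_snd f2)).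
Qed.

End Arithmetic.

(** Shift-and-add multiplication: the state is the partial product and the shifted multiplicand. *)
Definition prod_step (st : bitseq * bitseq) (x : bool) : bitseq * bitseq :=
  (if x then bits_sum st.1 st.2 else st.1, false :: st.2).

Definition bits_prod (a b : bitseq) : bitseq := (foldl prod_step ([::], a) b).1.

Lemma foldl_prod_step st b :
  bin_val (foldl prod_step st b).1 = bin_val st.1 + bin_val st.2 * bin_val b.
Proof.
elim: b st => [|x b IHb] [p s]; first by rewrite /= muln0 addn0.
rewrite [foldl _ _ _]/= IHb /prod_step [fst _]/= [snd _]/= !bin_val_cons.
by case: x; rewrite ?bin_val_bits_sum /=; nia.
Qed.

Lemma bin_val_bits_prod a b : bin_val (bits_prod a b) = bin_val a * bin_val b.
Proof. by rewrite /bits_prod foldl_prod_step. Qed.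

(** The maximum is the right measure, since a sum is one bit longer than its longer summand. The
    total length would grow by an amount depending on the accumulator, which [ptime_foldl]
    excludes. *)
Lemma size_prod_step st x :
  maxn (size (prod_step st x).1) (size (prod_step st x).2) <= maxn (size st.1)
    (size st.2) + 1.
Proof. by case: x => /=; rewrite ?size_bits_sum; lia. Qed.

Lemma size_foldl_prod_step st b :
  size (foldl prod_step st b).1 <= maxn (size st.1) (size st.2) + size b.
Proof.
elim: b st => [|x b IHb] st /=; first by lia.
by apply: leq_trans (IHb _) _; have := size_prod_step st x; lia.
Qed.

Lemma size_bits_prod a b : size (bits_prod a b) <= size a + size b.
Proof. by apply: leq_trans (size_foldl_prod_step _ _) _; rewrite max0n. Qed.

Lemma ptime_bits_prod (I : Type) (f : I -> tree) (a b : I -> bitseq) :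
  ptime f (fun i => enc_bits (a i)) -> ptime f (fun i => enc_bits (b i)) ->
  ptime f (fun i => enc_bits (bits_prod (a i) (b i))).
Proof.
move=> fa fb; pose enc_state := enc_pair enc_bits enc_bits.
suff /ptime_fst : ptime f (fun i => enc_state (foldl prod_step ([::], a i) (b i))) by [].
apply: (ptime_foldl (step := fun _ => prod_step) (G := fun _ _ => 1) (C := 20)
  (mu := fun st => maxn (size st.1) (size st.2)) _ fb).
- by apply: ptime_node fa; exact: (ptime_const f Leaf).
- pose F (z : I * (bitseq * bitseq) * bool) :=
    Node (f z.1.1) (Node (enc_state z.1.2) (enc_bool z.2)).
  have fp : ptime F (fun z => enc_bits z.1.2.1) by exact: (@ptime_expr (Hd (Hd (Tl (Var
    0))))).
  have fs : ptime F (fun z => enc_bits z.1.2.2) by exact: (@ptime_expr (Tl (Hd (Tl (Var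
    0))))).
  have fx : ptime F (fun z => enc_bool z.2) by exact: (@ptime_expr (Tl (Tl (Var 0)))).
  apply: ptime_node; last by apply: ptime_cons fs; exact: (ptime_const F Leaf).
  apply: eq_ptime (ptime_if fx (ptime_bits_sum fp fs) fp) => z /=.
  by case: (z.2).
- move=> [p s]; have := tree_size_enc_bits p; have := tree_size_enc_bits s.
  by rewrite /=; lia.
- move=> [p s]; have := tree_size_enc_bits p; have := tree_size_enc_bits s.
  by rewrite /=; lia.
- exact: pbounded_const.
- by move=> i st x; exact: size_prod_step.
Qed.

(** Bits come least significant first, so each position where they differ overrides the verdict so
    far. Afterwards, any 1 left in [b] makes [b] larger. *)
Definition ltn_step (st : bitseq * bool) (x : bool) : bitseq * bool :=
  let y := head false st.1 in (behead st.1, if x (+) y then y else st.2).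

Definition bits_ltn (a b : bitseq) : bool :=
  let st := foldl ltn_step (b, false) a in foldl orb st.2 st.1.

Lemma foldl_orb c s : foldl orb c s = c || (0 < bin_val s).
Proof.
elim: s c => [|b s IHs] c; first by rewrite orbF.
rewrite [foldl _ _ _]/= IHs bin_val_cons -orbA; congr orb.
by case: b => //=; rewrite add0n double_gt0.
Qed.

Lemma bits_ltnE a b : bits_ltn a b = (bin_val a < bin_val b).
Proof.
(* The verdict on the lower positions acts like a carry: added to the right-hand side, it turns the
   strict comparison into a weak one. *)
suff H st : foldl orb (foldl ltn_step st a).2 (foldl ltn_step st a).1 =
    (bin_val a < bin_val st.1 + st.2) by rewrite [LHS]H addn0.
elim: a st => [|x a IHa] [s c].
  by rewrite [LHS]foldl_orb /=; case: c; rewrite /= ?addn0 ?addn1.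
rewrite [foldl _ _ (x :: a)]/= IHa /ltn_step [fst _]/= [snd _]/= bin_val_cons.
case: s => [|y s]; rewrite ?[head _ _]/= ?[behead _]/= ?bin_val_cons /=.
  by case: x; case: c => /=; lia.
by case: x; case: y; case: c => /=; lia.
Qed.

Lemma ptime_bits_ltn (I : Type) (f : I -> tree) (a b : I -> bitseq) :
  ptime f (fun i => enc_bits (a i)) -> ptime f (fun i => enc_bits (b i)) ->
  ptime f (fun i => enc_bool (bits_ltn (a i) (b i))).
Proof.
move=> fa fb; pose enc_state := enc_pair enc_bits enc_bool.
have fst : ptime f (fun i => enc_state (foldl ltn_step (b i, false) (a i))).
  apply: (ptime_foldl_add (step := fun _ => ltn_step) (G := fun _ _ => 2) _ fa).
  - by apply: ptime_node fb _; exact: (ptime_const f Leaf).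
  - pose F (z : I * (bitseq * bool) * bool) :=
      Node (f z.1.1) (Node (enc_state z.1.2) (enc_bool z.2)).
    have fp : ptime F (fun z => enc_bits z.1.2.1) by exact: (@ptime_expr (Hd (Hd (Tl
      (Var 0))))).
    have fc : ptime F (fun z => enc_bool z.1.2.2) by exact: (@ptime_expr (Tl (Hd (Tl
      (Var 0))))).
    have fx : ptime F (fun z => enc_bool z.2) by exact: (@ptime_expr (Tl (Tl (Var 0)))).
    have fy := ptime_head false fp.
    apply: ptime_node; first exact: ptime_behead.
    by apply: ptime_if_bool => //; exact: ptime_addb.
  - exact: pbounded_const.
  - move=> i [s c] x; rewrite /enc_state /enc_pair /=.
    have : tree_size (enc_bits (behead s)) <= tree_size (enc_bits s).
      by case: s => //= u s; lia.
    have := tree_size_enc_bool (if x (+) head false s then head false s else c).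
    by have := tree_size_gt0 (enc_bool c); lia.
apply: (ptime_foldl_add (step := fun _ => orb) (G := fun _ _ => 2) (ptime_snd fst)
  (ptime_fst fst)).
- have fx : ptime (fun z : I * bool * bool => Node (f z.1.1) (Node (enc_bool z.1.2)
  (enc_bool z.2)))
    (fun z => enc_bool z.2) by exact: (@ptime_expr (Tl (Tl (Var 0)))).
  have fc : ptime (fun z : I * bool * bool => Node (f z.1.1) (Node (enc_bool z.1.2)
    (enc_bool z.2)))
    (fun z => enc_bool z.1.2) by exact: (@ptime_expr (Hd (Tl (Var 0)))).
  exact: ptime_if_bool fc (ptime_const _ (enc_bool true)) fx.
- exact: pbounded_const.
- by move=> i c x; case: c; case: x.
Qed.

Lemma bin_val_bin_digits n : bin_val (bin_digits n) = n.
Proof.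
have n_lt : n < 2 ^ (trunc_log 2 n).+1 by rewrite trunc_log_ltn.
(* Any digit count [k] with [n < 2 ^ k] will do; in this generality, induction on [k] can halve
   [n]. *)
rewrite /bin_digits; move: (trunc_log 2 n).+1 n_lt => k n_lt.
have -> : [seq odd (n %/ 2 ^ i) | i <- iota 0 k] = mkseq (fun i =>
  odd (n %/ 2 ^ i)) k by [].
elim: k n n_lt => [|j IHj] n n_lt.
  by move: n_lt; rewrite expn0 ltnS leqn0 => /eqP->.
rewrite /mkseq /= expn0 divn1 -[1]/(1 + 0) iotaDl -map_comp.
rewrite (_ : map _ _ = mkseq (fun i => odd (n./2 %/ 2 ^ i)) j); last first.
  by apply: eq_map => i /=; rewrite expnS divnMA divn2.
rewrite IHj; first exact: odd_double_half.
by rewrite ltn_half_double -mul2n -expnS.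
Qed.

(** * Sums of diagonal entries *)

(* [(P, M, D)] stands for the rational number [(P - M) / D]. *)
Definition fraction := (bitseq * bitseq * bitseq)%type.

Definition enc_fraction : fraction -> tree :=
  enc_pair (enc_pair enc_bits enc_bits) enc_bits.

Definition fraction_val (x : fraction) : rat :=
  (((bin_val x.1.1)%:R - (bin_val x.1.2)%:R) / (bin_val x.2)%:R)%R.

(** Keeping positive and negative parts apart avoids subtraction, and leaving fractions unreduced
    avoids computing a gcd. *)
Definition fraction_add (x : fraction) (r : rat) : fraction :=
  let n := bin_digits `|numq r|%N in
  let d := bin_digits `|denq r|%N in
  let u := bits_prod x.2 n in
  let p := bits_prod x.1.1 d in
  let m := bits_prod x.1.2 d in
  if (numq r < 0)%R then (p, bits_sum m u, bits_prod x.2 d)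
  else (bits_sum p u, m, bits_prod x.2 d).

(** The inequality [(P - M) / D < 1 / 2], cleared of its denominator and of subtraction. *)
Definition fraction_lt_half (x : fraction) : bool :=
  bits_ltn (bits_sum x.1.1 x.1.1) (bits_sum (bits_sum x.1.2 x.1.2) x.2).

Definition fraction_size (x : fraction) : nat :=
  maxn (size x.2) (maxn (size x.1.1) (size x.1.2)).

Lemma fraction_add_den x r :
  0 < bin_val x.2 -> 0 < bin_val (fraction_add x r).2.
Proof.
have d_gt0 : 0 < `|denq r|%N by rewrite absz_gt0 denq_neq0.
by move=> x_gt0; rewrite /fraction_add; case: ifP => _ /=;
  rewrite bin_val_bits_prod bin_val_bin_digits muln_gt0 x_gt0.
Qed.

Lemma fraction_val_add x r :
  0 < bin_val x.2 -> fraction_val (fraction_add x r) = (fraction_val x + r)%R.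
Proof.
move=> x_gt0; have den0 : ((bin_val x.2)%:R != 0 :> rat)%R by rewrite pnatr_eq0; lia.
have d0 : ((denq r)%:~R != 0 :> rat)%R by rewrite intr_eq0 denq_neq0.
have dE : (`|denq r|%N%:R = (denq r)%:~R :> rat)%R.
  by rewrite natr_absz gtr0_norm ?denq_gt0.
rewrite -{2}(divq_num_den r) /fraction_val /fraction_add.
case: ifP => sgn /=; rewrite ?(bin_val_bits_sum, bin_val_bits_prod, bin_val_bin_digits)
  !(natrD, natrM) dE.
  have nE : (`|numq r|%N%:R = - (numq r)%:~R :> rat)%R.
    by rewrite natr_absz ltr0_norm // rmorphN.
  by rewrite nE; field; rewrite den0 d0.
have nE : (`|numq r|%N%:R = (numq r)%:~R :> rat)%R.
  by rewrite natr_absz ger0_norm // leNgt sgn.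
by rewrite nE; field; rewrite den0 d0.
Qed.

Lemma fraction_lt_halfE x :
  0 < bin_val x.2 -> fraction_lt_half x = (fraction_val x < 1 / 2)%R.
Proof.
move=> x_gt0; rewrite /fraction_lt_half bits_ltnE !bin_val_bits_sum.
rewrite /fraction_val ltr_pdivrMr ?ltr0n // -(ltr_nat rat) !natrD.
move: (_%:R)%R (_%:R)%R (_%:R)%R => p m d.
by apply/idP/idP; lra.
Qed.

(** Multiplication adds lengths and addition costs one bit, so the increase depends on [r] alone, as
    [ptime_foldl] requires. *)
Lemma fraction_size_add x r :
  fraction_size (fraction_add x r) <=
  fraction_size x + (size (bin_digits `|numq r|%N) + size (bin_digits `|denq r|%N) + 1).
Proof.
case: x => [[p m] d]; rewrite /fraction_size /fraction_add.
set n := bin_digits `|numq r|; set e := bin_digits `|denq r|.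
have := size_bits_prod p e; have := size_bits_prod m e.
have := size_bits_prod d e; have := size_bits_prod d n.
by case: ifP => _ /=; rewrite size_bits_sum; lia.
Qed.

Section FractionTime.
Variables (I : Type) (f : I -> tree).
Implicit Types (x : I -> fraction) (r : I -> rat).

Lemma ptime_fraction_add x r :
  ptime f (fun i => enc_fraction (x i)) -> ptime f (fun i => enc_rat (r i)) ->
  ptime f (fun i => enc_fraction (fraction_add (x i) (r i))).
Proof.
move=> fx fr.
have fD : ptime f (fun i => enc_bits (x i).2) := ptime_snd fx.
have fP : ptime f (fun i => enc_bits (x i).1.1) := ptime_fst (ptime_fst fx).
have fM : ptime f (fun i => enc_bits (x i).1.2) := ptime_snd (ptime_fst fx).
have fs : ptime f (fun i => enc_bool (numq (r i) < 0)%R) := ptime_fst (ptime_fst fr).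
have fn : ptime f (fun i => enc_bits (bin_digits `|numq (r i)|%N)) := ptime_snd
  (ptime_fst fr).
have fd : ptime f (fun i => enc_bits (bin_digits `|denq (r i)|%N)) := ptime_snd
  (ptime_snd fr).
have fu := ptime_bits_prod fD fn; have fp := ptime_bits_prod fP fd.
have fm := ptime_bits_prod fM fd; have fe := ptime_bits_prod fD fd.
apply: eq_ptime (ptime_if fs (ptime_node (ptime_node fp (ptime_bits_sum fm fu)) fe)
  (ptime_node (ptime_node (ptime_bits_sum fp fu) fm) fe)) => i.
by rewrite /fraction_add; case: ifP.
Qed.

Lemma ptime_fraction_lt_half x :
  ptime f (fun i => enc_fraction (x i)) ->
  ptime f (fun i => enc_bool (fraction_lt_half (x i))).
Proof.
move=> fx.
have fD : ptime f (fun i => enc_bits (x i).2) := ptime_snd fx.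
have fP : ptime f (fun i => enc_bits (x i).1.1) := ptime_fst (ptime_fst fx).
have fM : ptime f (fun i => enc_bits (x i).1.2) := ptime_snd (ptime_fst fx).
by apply: ptime_bits_ltn; do ?apply: ptime_bits_sum.
Qed.

End FractionTime.

(** The type [local_term p] varies with the instance through [p]. Forgetting [p] gives folds a fixed
    element type and leaves the encoding unchanged. *)
Definition raw_term := (seq nat * seq (seq gaussian_rat))%type.

Definition enc_raw_term : raw_term -> tree :=
  enc_pair (enc_seq enc_unary) (enc_seq (enc_seq enc_gaussian_rat)).

Definition raw_of_term (p : nat) (h : local_term p) : raw_term :=
  ([seq val i | i <- lt_supp h], lt_rows h).

Lemma enc_seq_map (T T' : Type) (g : T -> T') (enc : T' -> tree) (l : seq T) :
  enc_seq enc (map g l) = enc_seq (enc \o g) l.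
Proof. by elim: l => //= x l ->. Qed.

Lemma enc_hamiltonian_raw (p : nat) (H : hamiltonian p) :
  enc_hamiltonian H = enc_seq enc_raw_term (map (@raw_of_term p) H).
Proof.
rewrite enc_seq_map; elim: H => //= h H ->.
by rewrite /enc_raw_term /enc_pair /= enc_seq_map.
Qed.

Definition diagonal_index (y : bitseq) (h : raw_term) : nat :=
  bin_val [seq nth false y w | w <- h.1].

Definition raw_diagonal (y : bitseq) (h : raw_term) : rat :=
  (nth (0, 0)%R (nth [::] h.2 (diagonal_index y h)) (diagonal_index y h)).1.

Definition diagonal_sum (y : bitseq) (hs : seq raw_term) : fraction :=
  foldl (fun x h => fraction_add x (raw_diagonal y h)) ([::], [::], [:: true]) hs.

Lemma diagonal_sum_val y hs :
  0 < bin_val (diagonal_sum y hs).2 /\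
  fraction_val (diagonal_sum y hs) = (\sum_(h <- hs) raw_diagonal y h)%R.
Proof.
suff H x : 0 < bin_val x.2 ->
    let x' := foldl (fun x h => fraction_add x (raw_diagonal y h)) x hs in
    0 < bin_val x'.2 /\
    fraction_val x' = (fraction_val x + \sum_(h <- hs) raw_diagonal y h)%R.
  have [//|gt0 ->] := H ([::], [::], [:: true]); split=> //.
  by rewrite /fraction_val subrr mul0r add0r.
elim: hs x => [|h hs IHhs] x x_gt0 /=; first by rewrite big_nil addr0.
have [gt0 ->] := IHhs _ (fraction_add_den (raw_diagonal y h) x_gt0); split=> //.
by rewrite fraction_val_add // big_cons addrA.
Qed.

Section DiagonalTime.
Variables (I : Type) (f : I -> tree).

(** Wires are unary, so a proof bit is found by dropping elements; the matrix index is binary and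
    uses the halving lookup. *)
Lemma ptime_raw_diagonal (y : I -> bitseq) (h : I -> raw_term) :
  ptime f (fun i => enc_bits (y i)) -> ptime f (fun i => enc_raw_term (h i)) ->
  ptime f (fun i => enc_rat (raw_diagonal (y i) (h i))).
Proof.
move=> fy fh.
have fs : ptime f (fun i => enc_seq enc_unary (h i).1) := ptime_fst fh.
have fr : ptime f (fun i => enc_seq (enc_seq enc_gaussian_rat) (h i).2) := ptime_snd fh.
have fb : ptime f (fun i => enc_bits [seq nth false (y i) w | w <- (h i).1]).
  apply: (ptime_map (g := fun i w => nth false (y i) w) _ fs).
  apply: ptime_nth_unary; first exact: (@ptime_expr (Tl (Var 0))).
  apply: ptime_trans (ptime_reindex fst fy).
  exact: (@ptime_expr (Hd (Var 0))).
exact: ptime_fst (ptime_nth_bits (0, 0)%R fb (ptime_nth_bits [::] fb fr)).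
Qed.

End DiagonalTime.

Lemma ptime_diagonal_sum (I : Type) (f : I -> tree) (y : I -> bitseq)
    (hs : I -> seq raw_term) :
  ptime f (fun i => enc_bits (y i)) ->
  ptime f (fun i => enc_seq enc_raw_term (hs i)) ->
  ptime f (fun i => enc_fraction (diagonal_sum (y i) (hs i))).
Proof.
move=> fy fhs.
have fd : ptime (fun z : I * raw_term => Node (f z.1) (enc_raw_term z.2))
    (fun z => enc_rat (raw_diagonal (y z.1) z.2)).
  apply: ptime_raw_diagonal; last exact: (@ptime_expr (Tl (Var 0))).
  apply: ptime_trans (ptime_reindex fst fy).
  exact: (@ptime_expr (Hd (Var 0))).
apply: (ptime_foldl (step := fun i x h => fraction_add x (raw_diagonal (y i) h))
  (mu := fraction_size) (C := 20)
  (G := fun i h => size (bin_digits `|numq (raw_diagonal (y i) h)|%N) +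
                   size (bin_digits `|denq (raw_diagonal (y i) h)|%N) + 1) _ fhs).
- exact: (ptime_const f (enc_fraction ([::], [::], [:: true]))).
- apply: ptime_fraction_add; first exact: (@ptime_expr (Hd (Tl (Var 0)))).
  apply: ptime_trans (ptime_reindex (fun z : I * fraction * raw_term => (z.1.1, z.2)) fd).
  exact: (@ptime_expr (Cons (Hd (Var 0)) (Tl (Tl (Var 0))))).
- move=> [[p m] d]; rewrite /fraction_size /enc_fraction /enc_pair /=.
  have := tree_size_enc_bits p; have := tree_size_enc_bits m.
  by have := tree_size_enc_bits d; lia.
- move=> [[p m] d]; rewrite /fraction_size /enc_fraction /enc_pair /=.
  have := tree_size_enc_bits p; have := tree_size_enc_bits m.
  by have := tree_size_enc_bits d; lia.
- apply: pbounded_add; last exact: pbounded_const.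
  apply: (@pbounded_le _ _ (fun z => tree_size (enc_rat (raw_diagonal (y z.1) z.2)))).
    apply: pbounded_trans (ptime_size fd).
    by exists 1 => z /=; rewrite expn1; lia.
  move=> z; cbv beta; move: (raw_diagonal _ _) => r.
  rewrite /enc_rat /enc_int /enc_bin.
  move: (bin_digits _) (bin_digits _) => d n /=.
  by have := tree_size_enc_bits d; have := tree_size_enc_bits n; lia.
- by move=> i x h; apply: fraction_size_add.
Qed.

(** * Translating classical-proof circuits into quantum-proof circuits *)

Definition qcircuit_of_ccircuit (V : ccircuit) : qcircuit :=
  @QCircuit (cc_work V) (cc_proof V)
    ([seq Unitary g | g <- cc_pre V] ++
     [seq Read rt.1 rt.2 | rt <- cc_reads V] ++
     [seq Unitary g | g <- cc_post V]).

(** Gate types depend on the number of wires, hence on the instance. Seen as lists of trees, encoded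
    gate lists have one element type, as [ptime_map] needs. *)
Lemma enc_seq_id (T : Type) (enc : T -> tree) (l : seq T) :
  enc_seq enc l = enc_seq id (map enc l).
Proof. by rewrite enc_seq_map. Qed.

Lemma ptime_qcircuit_of_ccircuit (I : Type) (f : I -> tree) (V : I -> ccircuit) :
  ptime f (fun i => enc_ccircuit (V i)) ->
  ptime f (fun i => enc_qcircuit (qcircuit_of_ccircuit (V i))).
Proof.
move=> fV.
(* On encodings, the translation merely puts a constructor tag before each item: 0 for [Unitary], 2
   for [Read]. *)
have tag (t : tree) (l : I -> seq tree) : ptime f (fun i => enc_seq id (l i)) ->
    ptime f (fun i => enc_seq id (map (Node t) (l i))).
  apply: (ptime_map (enc' := id) (g := fun _ => Node t)).
  apply: ptime_node; first exact: ptime_const.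
  exact: (@ptime_expr (Tl (Var 0))).
have fw := ptime_fst fV; have fp := ptime_fst (ptime_snd fV).
have fpre : ptime f (fun i => enc_seq id (map (@enc_ugate _) (cc_pre (V i)))).
  by apply: eq_ptime (ptime_fst (ptime_snd (ptime_snd fV))) => i; rewrite enc_seq_id.
have freads : ptime f (fun i => enc_seq id [seq Node (enc_seq (@enc_wire _) rt.1)
  (enc_wire rt.2)
    | rt <- cc_reads (V i)]).
  apply: eq_ptime (ptime_fst (ptime_snd (ptime_snd (ptime_snd fV)))) => i.
  by rewrite enc_seq_id.
have fpost : ptime f (fun i => enc_seq id (map (@enc_ugate _) (cc_post (V i)))).
  apply: eq_ptime (ptime_snd (ptime_snd (ptime_snd (ptime_snd fV)))) => i.
  by rewrite enc_seq_id.
apply: eq_ptime (ptime_node fw (ptime_node fp (ptime_cat (tag (enc_unary 0) _ fpre)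
  (ptime_cat (tag (enc_unary 2) _ freads) (tag (enc_unary 0) _ fpost))))) => i.
by rewrite /enc_qcircuit /= [in RHS]enc_seq_id !map_cat -!map_comp.
Qed.

(** * Classical proofs as quantum proofs *)

Section Simulation.
Local Open Scope ring_scope.
Local Open Scope complex_scope.
Variable R : realType.

Lemma abs2_ge0 (z : R[i]) : 0 <= abs2 z.
Proof. by rewrite /abs2 addr_ge0 ?sqr_ge0. Qed.

Lemma abs2M (w z : R[i]) : abs2 (w * z) = abs2 w * abs2 z.
Proof. by case: w z => [a b] [c d]; rewrite /abs2 /=; ring. Qed.

Lemma apply_ugate_scale m (g : ugate m) c (psi : state R m) :
  apply_ugate g (fun a => c * psi a) = (fun a => c * apply_ugate g psi a).
Proof. by apply: funext => a; case: g => [w|w|w t] //=; ring. Qed.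

Lemma run_ugates_scale m (gs : seq (ugate m)) c (psi : state R m) :
  run_ugates gs (fun a => c * psi a) = (fun a => c * run_ugates gs psi a).
Proof.
rewrite /run_ugates; elim: gs psi => //= g gs IHgs psi.
by rewrite apply_ugate_scale IHgs.
Qed.

Lemma first_qubit_prob_scale m c (psi : state R m.+1) :
  first_qubit_prob (fun a => c * psi a) = abs2 c * first_qubit_prob psi.
Proof.
by rewrite /first_qubit_prob mulr_sumr; apply: eq_bigr => a _; rewrite abs2M.
Qed.

Lemma project_scale m (s : seq 'I_m) v c (psi : state R m) :
  project s v (fun a => c * psi a) = (fun a => c * project s v psi a).
Proof. by apply: funext => a; rewrite /project; case: ifP => _; rewrite ?mulr0. Qed.

Lemma accept_prob_unitary p m (gs : seq (ugate m.+1)) gs' (psi : qstate R p m.+1) :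
  accept_prob ([seq Unitary g | g <- gs] ++ gs') psi =
  accept_prob gs' (fun y => run_ugates gs (psi y)).
Proof. by elim: gs psi => //= g gs IHgs psi; rewrite IHgs. Qed.

(** * Commuting reads with index measurements *)

Lemma setbE m (a : bits m) i b j : setb a i b j = if j == i then b else a j.
Proof. by rewrite ffunE. Qed.

(** Several reads may share a target; this closed form, an XOR over all of them, shows that their
    order is irrelevant. *)
Definition answer p m (y : bits p) (rs : seq (seq 'I_m * 'I_m)) (v : bits m) (i :
  'I_m) : bool :=
  \big[addb/false]_(rt <- rs | rt.2 == i) proof_bit y (register_value rt.1 v).

Lemma xor_answersE p m (y : bits p) (rs : seq (seq 'I_m * 'I_m)) v (a : bits m) i :
  xor_answers y rs v a i = a i (+) answer y rs v i.
Proof.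
rewrite /answer; elim: rs a => [|[r t] rs IHrs] a; first by rewrite big_nil addbF.
rewrite big_cons /= IHrs setbE [t == i]eq_sym.
by case: eqP => [->|//]; rewrite addbA.
Qed.

(** States are functions of the basis label, so the reads of a circuit act on that label in reverse
    order: the head read comes last here, but first in [xor_answers]. *)
Lemma xor_answers_cons p m (y : bits p) (rs : seq (seq 'I_m * 'I_m)) r t v (a : bits m) :
  let a' := xor_answers y rs v a in
  xor_answers y ((r, t) :: rs) v a = setb a' t (a' t (+) proof_bit y (register_value r
    v)).
Proof.
apply/ffunP => i; rewrite setbE !xor_answersE /answer big_cons /= [t == i]eq_sym.
by case: eqP => [->|//]; rewrite -addbA; congr addb; rewrite addbC.
Qed.

Lemma eq_register_value m (r : seq 'I_m) (v v' : bits m) :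
  {in r, v =1 v'} -> register_value r v = register_value r v'.
Proof. by move=> Ev; rewrite /register_value; congr bin_val; apply/eq_in_map. Qed.

Lemma eq_xor_answers p m (y : bits p) (rs : seq (seq 'I_m * 'I_m)) (v v' a : bits m) :
  {in index_wires rs, v =1 v'} -> xor_answers y rs v a = xor_answers y rs v' a.
Proof.
rewrite /xor_answers /index_wires; elim: rs a => //= [[r t] rs IHrs] a /= Ev.
rewrite (@eq_register_value _ r v v') => [|i i_r]; last by rewrite Ev // mem_cat i_r.
by apply: IHrs => i i_rs; rewrite Ev // mem_cat i_rs orbT.
Qed.

(** An out-of-range index means no access on the left and the answer [false] on the right, whose XOR
    changes nothing. *)
Lemma readE p m (psi : qstate R p m) (t : 'I_m) k y a :
  read (insub k) t psi y a = psi y (setb a t (a t (+) proof_bit y k)).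
Proof.
rewrite /read /proof_bit; case: (insub k) => // ; congr psi.
by apply/ffunP => i; rewrite setbE addbF; case: eqP => [->|].
Qed.

Definition restrict m (s : seq 'I_m) (v : bits m) : bits m := [ffun i =>
  (i \in s) && v i].

Lemma outcome_notin m (s : seq 'I_m) v i : outcome s v -> i \notin s -> v i = false.
Proof. by move=> /forallP/(_ i); case: (i \in s); case: (v i). Qed.

Lemma restrict_id m (s : seq 'I_m) v : (restrict s v == v) = outcome s v.
Proof.
apply/eqP/idP => [<-|s_v]; first by apply/forallP => i; rewrite ffunE; apply/implyP =>
  /andP[].
by apply/ffunP => i; rewrite ffunE; case: (boolP (i \in s)) => // /(outcome_notin s_v) ->.
Qed.

(** By induction, measuring [r], reading into [t] and then measuring the remaining registers amounts
    to one joint measurement: [t] is not an index wire, so the read leaves all registers alone.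
    Registers may overlap; outcomes that disagree on the overlap leave the zero state, which
    [accept0] discards. *)
Lemma accept_prob_reads p m rs gs' (psi : qstate R p m.+1) :
  accept_prob gs' (fun (_ : bits p) (_ : bits m.+1) => 0 : R[i]) = 0 ->
  all (fun rt => rt.2 \notin index_wires rs) rs ->
  accept_prob ([seq Read rt.1 rt.2 | rt <- rs] ++ gs') psi =
  \sum_(v : bits m.+1 | outcome (index_wires rs) v)
    accept_prob gs' (fun y a =>
      project (index_wires rs) v (psi y) (xor_answers y rs v a)).
Proof.
move=> accept0; elim: rs psi => [|[r t] rs IHrs] psi.
  move=> _; rewrite (big_pred1 [ffun=> false]) => [|v]; last first.
    rewrite -restrict_id; apply/eqP/eqP => [<-|->]; apply/ffunP => i; rewrite !ffunE //.
  congr accept_prob; apply: funext => y; apply: funext => a.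
  by rewrite /project; case: ifP => // /forallP[] i.
set s := index_wires rs; rewrite [index_wires _](_ : _ = r ++ s) // => wf_rs.
have [t_rs {}wf_rs] : t \notin r ++ s /\ all (fun rt => rt.2 \notin r ++ s) rs.
  exact/andP.
have [t_r t_s] : t \notin r /\ t \notin s.
  by apply/andP; move: t_rs; rewrite mem_cat negb_or.
have wf : all (fun rt => rt.2 \notin s) rs.
  by apply: sub_all wf_rs => rt; rewrite mem_cat negb_or => /andP[].
pose glue (v1 v' : bits m.+1) : bits m.+1 := [ffun i => if i \in r then v1 i else v' i].
pose compat (v1 v' : bits m.+1) := [forall i, (i \in r) && (i \in s) ==> (v1 i == v' i)].
rewrite [LHS]/= [RHS](partition_big (restrict r) (outcome r)); last first.
  by move=> v _; rewrite -restrict_id; apply/eqP/ffunP => i; rewrite !ffunE andbA andbb.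
apply: eq_bigr => v1 out1; rewrite IHrs //.
(* For an incompatible pair, no basis label passes both projections, so the branch vanishes. *)
rewrite [LHS](bigID (compat v1)) [LHS]/= [X in _ + X]big1 ?addr0; last first.
  move=> v' /andP[_]; rewrite /compat negb_forall; case/existsP=> i;
    rewrite negb_imply => /andP[/andP[i_r i_s] ne_i].
  rewrite -[RHS]accept0; congr accept_prob; apply: funext => y; apply: funext => a.
  rewrite /project; case: ifP => // /forall_inP/(_ i i_s)/eqP Ei.
  rewrite readE; case: ifP => // /forall_inP/(_ i i_r); rewrite setbE.
  case: (i =P t) => [Eit|_]; first by rewrite Eit (negPf t_r) in i_r.
  by rewrite Ei eq_sym (negPf ne_i).
(* For fixed [v1], compatible outcomes [v'] on [s] correspond to joint outcomes extending [v1], via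
   [glue v1] and [restrict s]. *)
rewrite [RHS](reindex_onto (glue v1) (restrict s)); last first.
  move=> v /andP[out /eqP <-]; apply/ffunP => i; rewrite !ffunE.
  case: (boolP (i \in r)) => i_r //=; case: (boolP (i \in s)) => //= i_s.
  by rewrite (outcome_notin out) // mem_cat negb_or i_r.
apply: eq_big => [v'|v' /andP[out' cmp]].
  apply/idP/idP.
    case/andP=> out' /forallP cmp; apply/andP; split; [apply/andP; split|].
    - apply/forallP => i; rewrite ffunE mem_cat; case: (i \in r); rewrite ?implybT //;
      exact: (forallP out').
    - apply/eqP/ffunP => i; rewrite !ffunE; case: (boolP (i \in r)) =>
      //= /(outcome_notin out1) -> //.
    - apply/eqP/ffunP => i; rewrite !ffunE; case: (boolP (i \in s)) => i_s /=.
        by case: (boolP (i \in r)) => // i_r; apply/eqP; have := cmp i; rewrite i_r i_s.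
      by rewrite (outcome_notin out').
  case/andP=> /andP[_ _] /eqP/ffunP E'; apply/andP; split.
    by apply/forallP => i; rewrite -(E' i) ffunE; apply/implyP => /andP[].
  apply/forallP => i; apply/implyP => /andP[i_r i_s].
  by rewrite -(E' i) !ffunE i_s i_r.
have glue_r : {in r, glue v1 v' =1 v1} by move=> i i_r; rewrite ffunE i_r.
have glue_s : {in s, glue v1 v' =1 v'}.
  move=> i i_s; rewrite ffunE; case: ifPn => // i_r; apply/eqP.
  by have /forallP/(_ i) := cmp; rewrite i_r i_s.
congr accept_prob; apply: funext => y; apply: funext => a.
rewrite xor_answers_cons (eq_xor_answers _ _ glue_s) (eq_register_value glue_r).
rewrite /project readE; set b := xor_answers _ _ _ _; set b' := setb b _ _.
have b's : {in s, b' =1 b}.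
  by move=> i i_s; rewrite setbE; case: eqP => // Eit; rewrite Eit (negPf t_s) in i_s.
have -> : [forall (i | i \in r ++ s), b' i == glue v1 v' i] =
    [forall (i | i \in s), b i == v' i] && [forall (i | i \in r), b' i == v1 i].
  apply/forall_inP/andP => [H|[/forall_inP Hs /forall_inP Hr] i].
    split; apply/forall_inP => i i_in.
      by rewrite -b's // -glue_s // H // mem_cat i_in orbT.
    by rewrite -glue_r // H // mem_cat i_in.
  by rewrite mem_cat => /orP[] i_in; [rewrite glue_r // Hr|rewrite glue_s // b's // Hs].
by case: ifP.
Qed.

Lemma first_qubit_prob0 m (gs : seq (ugate m.+1)) :
  first_qubit_prob (run_ugates gs (fun=> 0 : R[i])) = 0.
Proof.
have -> : (fun _ : bits m.+1 => 0 : R[i]) = (fun a => 0 * (fun=> 0) a).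
  by apply: funext => a; rewrite mulr0.
rewrite run_ugates_scale first_qubit_prob_scale.
by rewrite /abs2 /= expr0n /= addr0 mul0r.
Qed.

(* The verifier only reads, so a quantum proof acts as the distribution
   [|xi y|^2] over classical proofs. *)
Lemma qc_accept_qcircuit_of_ccircuit n (V : ccircuit) x (xi : state R (cc_proof V)) :
  ccircuit_wf n V ->
  qc_accept (V := qcircuit_of_ccircuit V) x xi =
  \sum_(y : bits (cc_proof V)) abs2 (xi y) * cc_accept R x y.
Proof.
case/and4P=> _ _ _ wf; rewrite /qc_accept /= accept_prob_unitary accept_prob_reads //;
  last first.
  rewrite -[map _ _]cats0 accept_prob_unitary /=.
  by apply: big1 => y _; rewrite first_qubit_prob0.
under [RHS]eq_bigr do rewrite /cc_accept mulr_sumr.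
rewrite exchange_big; apply: eq_bigr => v _.
rewrite -[map _ _]cats0 accept_prob_unitary /=; apply: eq_bigr => y _.
(* Reads never alter the proof string, so different [y] do not interfere; for each one the factor
   [xi y] passes through the whole run and comes out as [abs2 (xi y)]. *)
rewrite run_ugates_scale project_scale run_ugates_scale first_qubit_prob_scale.
by [].
Qed.

Lemma unit_basis_state n (b : bits n) : unit_state (basis_state R b).
Proof.
rewrite /unit_state (bigD1 b) //= big1 ?addr0 => [|a /negPf a_b].
  by rewrite /basis_state eqxx /abs2 /= expr1n expr0n /= addr0.
by rewrite /basis_state a_b /abs2 /= expr0n /= addr0.
Qed.

Lemma sum_abs2_basis_state n (b : bits n) (F : bits n -> R) :
  \sum_a abs2 (basis_state R b a) * F a = F b.
Proof.
rewrite (bigD1 b) //= big1 ?addr0 => [|a /negPf a_b].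
  by rewrite /basis_state eqxx /abs2 /= expr1n expr0n /= addr0 mul1r.
by rewrite /basis_state a_b /abs2 /= expr0n /= addr0 mul0r.
Qed.

Lemma expectation_basis_state p (H : hamiltonian p) (b : bits p) :
  expectation H (basis_state R b) = ham_entry R H b b.
Proof.
rewrite /expectation (bigD1 b) //= [X in _ + X]big1 ?addr0 => [|a /negPf a_b].
  rewrite (bigD1 b) //= big1 ?addr0 => [|a /negPf a_b].
    by rewrite /basis_state eqxx conjC1 mul1r mulr1.
  by rewrite /basis_state a_b mulr0.
by apply: big1 => a' _; rewrite /basis_state a_b conjC0 !mul0r.
Qed.

(** A label agrees with itself outside the support, so each term contributes a table lookup. Any bit
    string [y] is allowed: missing bits count as [false] and surplus bits are ignored on both
    sides. *)
Lemma Re_ham_entry_diagonal p (H : hamiltonian p) (y : bitseq) :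
  let b : bits p := [ffun i : 'I_p => nth false y i] in
  complex.Re (ham_entry R H b b) =
  ratr (\sum_(h <- map (@raw_of_term p) H) raw_diagonal y h).
Proof.
move=> b; rewrite /ham_entry raddf_sum /= rmorph_sum big_map.
apply: eq_bigr => h _; rewrite /term_entry.
have -> : [forall (i | i \notin lt_supp h), b i == b i] by apply/forall_inP.
rewrite /raw_diagonal /=; have -> : diagonal_index y (raw_of_term h) = register_value
  (lt_supp h) b.
  rewrite /diagonal_index /register_value /= -map_comp; congr bin_val.
  by apply: eq_map => i /=; rewrite ffunE.
by [].
Qed.

End Simulation.

(** * The theorem *)

Local Open Scope ring_scope.

Lemma QPCP_verifier_of_QCPCP (R : realType) (q : nat) (V : nat -> ccircuit) A :
  QCPCP_verifier R q V A ->
  QPCP_verifier R q (fun n => qcircuit_of_ccircuit (V n)) A.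
Proof.
move=> [polyV wfV yesV noV]; split.
- apply/poly_time_of_ptime/ptime_qcircuit_of_ccircuit.
  exact: (ptime_of_poly_time_on (h := id) polyV).
- move=> n; have [/and4P[n_le wf_pre wf_post wf_rs] size_rs] := wfV n; split.
    rewrite /qcircuit_wf n_le /= !all_cat !all_map; apply/and3P; split=> //.
    exact/allP.
  rewrite /= !count_cat !count_map (eq_count (a2 := pred0)) // count_pred0 add0n.
  rewrite [X in (_ + X)%N](eq_count (a2 := pred0)) // count_pred0 addn0.
  by apply: leq_trans size_rs; exact: count_size.
- move=> x /yesV[y accy]; exists (basis_state R y); split; first exact: unit_basis_state.
  rewrite (qc_accept_qcircuit_of_ccircuit _ _ (proj1 (wfV _))).
  by rewrite (sum_abs2_basis_state y (fun y => cc_accept R x y)).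
- move=> x /noV rejx xi xi1.
  rewrite (qc_accept_qcircuit_of_ccircuit _ _ (proj1 (wfV _))).
  rewrite -[leRHS]mul1r -[X in X * _]xi1 mulr_suml; apply: ler_sum => y _.
  by rewrite ler_wpM2l ?abs2_ge0 ?rejx.
Qed.

(** The encoded circuit contains the proof length in unary, so its size bounds the length of the NP
    witness. *)
Lemma pbounded_proof (V : nat -> ccircuit) :
  poly_time enc_unary (fun n => enc_ccircuit (V n)) ->
  pbounded (fun x : bitseq => size x) (fun x => cc_proof (V (size x))).
Proof.
have size_unary n : tree_size (enc_unary n) = n.*2.+1.
  by rewrite /enc_unary; elim: n => //= n ->; lia.
move=> polyV; apply: (@pbounded_reindex _ _ (fun x : bitseq => size x) id (fun n =>
  cc_proof (V n))).
have := ptime_size (ptime_of_poly_time_on (h := id) polyV (fun=> I)).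
move=> /(pbounded_trans (n := id)) H.
apply: pbounded_le (H _) _ => [|n].
  apply: (@pbounded_le _ _ (fun n => n + n + 1)%N) => [|n]; last by rewrite size_unary;
    lia.
  do ?apply: pbounded_add; try exact: pbounded_refl; exact: pbounded_const.
rewrite /enc_ccircuit; have := size_unary (cc_proof (V n)).
by move: (enc_unary (cc_proof (V n))) => t /= ->; lia.
Qed.

Lemma QCPCP_subclass_NP (R : realType) (q l : nat) (eps : R)
    (H : forall Vx : bitseq * qcircuit, hamiltonian (qc_proof Vx.2)) :
  eps < 1 / 6 -> is_hamiltonian_reduction q l eps H -> subclass (QCPCP R q) NP.
Proof.
move=> heps [polyH approxH] A [V verV].
have [polyV wfV yesV noV] := verV.
pose inst x := (x, qcircuit_of_ccircuit (V (size x))) : bitseq * qcircuit.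
(* A verifier's circuit for length [|x|] qualifies whether or not [x] satisfies the promise of [A],
   so the reduction applies to every [x] and [M] is polynomial-time on all inputs. *)
have instP x : is_QPCP_circuit R q (inst x).
  by do 2!eexists; split; [exact: QPCP_verifier_of_QCPCP verV|].
pose raw x := map (@raw_of_term _) (H (inst x)).
pose M x y := fraction_lt_half (diagonal_sum y (raw x)).
(* Relating [b] and [y] bitwise serves both directions: [y] lists the bits of a given proof [b], or
   [b] is an arbitrary [y] padded with [false] or cut to length. *)
have energy x (y : bitseq) (b : bits (cc_proof (V (size x)))) :
    (forall i : 'I__, b i = nth false y i) ->
    exists e : R, `|cc_accept R x b - (1 - e)| <= eps /\ M x y = (e < 1 / 2).
  move=> Eb; have {}Eb : b = [ffun i : 'I__ => nth false y i].
    by apply/ffunP => i; rewrite ffunE.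
  have [_ /(_ _ (unit_basis_state R b))] := approxH _ (instP x).
  rewrite expectation_basis_state (qc_accept_qcircuit_of_ccircuit _ _ (proj1 (wfV _))).
  rewrite (sum_abs2_basis_state b (fun y => cc_accept R x y)) => le_eps.
  exists (complex.Re (ham_entry R (H (inst x)) b b)); split.
    (* The acceptance probability is real, so taking the real part of the complex error does not
       increase its modulus. *)
    rewrite -lecR; apply: le_trans le_eps; apply: le_trans (normc_ge_Re _).
    by rewrite !raddfB.
  rewrite Eb Re_ham_entry_diagonal /M.
  have [D_gt0 <-] := diagonal_sum_val y (raw x).
  have -> : 1 / 2 = ratr (1 / 2) :> R by rewrite rmorphM rmorph1 fmorphV rmorph_nat.
  by rewrite fraction_lt_halfE // ltr_rat.
have [k Hk] := (pboundedP _ _).1 (pbounded_proof polyV).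
exists M, k; split.
- apply: poly_time_of_ptime.
  set f := (X in ptime X _).
  have fx : ptime f (fun xy => enc_bits xy.1) by exact: (@ptime_expr (Hd (Var 0))).
  have fV := ptime_trans (ptime_unary_size fx)
    (ptime_of_poly_time_on (h := fun xy : bitseq * bitseq => size xy.1) polyV (fun=> I)).
  have fH := ptime_trans (ptime_node fx (ptime_qcircuit_of_ccircuit fV))
    (ptime_of_poly_time_on (h := fun xy : bitseq * bitseq =>
      inst xy.1) polyH (fun xy => instP xy.1)).
  apply: ptime_fraction_lt_half; apply: ptime_diagonal_sum.
    exact: (@ptime_expr (Tl (Var 0))).
  by apply: eq_ptime fH => xy; rewrite enc_hamiltonian_raw.
- move=> x /yesV[b accb]; exists [seq b i | i <- enum 'I__]; split.
    by rewrite size_map size_enum_ord; exact: Hk.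
  have [i|e [le_eps ->]] := energy x [seq b i | i <- enum 'I__] b.
    by rewrite (nth_map i) ?size_enum_ord // nth_ord_enum.
  by move: le_eps; rewrite ler_norml => /andP[]; lra.
- move=> x /noV rejx y _.
  have [i|e [le_eps ->]] := energy x y [ffun i : 'I__ => nth false y i].
    by rewrite ffunE.
  have := rejx [ffun i : 'I__ => nth false y i].
  by move: le_eps; rewrite ler_norml -leNgt => /andP[]; lra.
Qed.

Lemma BQP_subclass_QCPCP (R : realType) (q : nat) : subclass (BQP R) (QCPCP R q).
Proof.
move=> A [C [polyC wfC yesC noC]].
pose V n := @CCircuit (bc_work (C n)) 0 (bc_gates (C n)) [::] [::].
have acceptE n x (y : bits 0) : cc_accept R (V := V n) x y = bc_accept R (C n) x.
  rewrite /cc_accept /= (big_pred1 [ffun=> false]) => [|v]; last first.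
    rewrite -restrict_id; apply/eqP/eqP => [<-|->]; apply/ffunP => i; rewrite !ffunE //.
  congr first_qubit_prob; apply: funext => a.
  by rewrite /project; case: ifP => // /forallP[] i.
exists V; split.
- apply: poly_time_of_ptime.
  have fC := ptime_of_poly_time_on (h := id) polyC (fun=> I).
  apply: ptime_trans fC _.
  (* The [Nil]s encode, in order, proof length 0, no reads and no gates after them. *)
  exact: (@ptime_expr (Cons (Hd (Var 0)) (Cons Nil (Cons (Tl (Var 0)) (Cons Nil Nil))))).
- move=> n; split=> //; have /andP[n_le wf_gates] := wfC n.
  by rewrite /ccircuit_wf n_le /= wf_gates.
- by move=> x /yesC acc; exists [ffun=> false]; rewrite acceptE.
- by move=> x /noC rej y; rewrite acceptE.
Qed.

Theorem theorem7p1 (R : realType) (q : nat) (eps : R) (heps : eps < 1 / 6) :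
  (~ subclass (QCPCP R q) NP ->
   ~ exists (c : nat)
            (H : forall Vx : bitseq * qcircuit, hamiltonian (qc_proof Vx.2)),
       is_hamiltonian_reduction q (c * q) eps H) /\
  (subclass (QCPCP R q) NP -> subclass (BQP R) NP).
Proof.
split=> [notNP [c [H redH]]|QCPCP_NP A /(@BQP_subclass_QCPCP R q A)];
  last exact: QCPCP_NP.
exact: notNP (QCPCP_subclass_NP heps redH).
Qed.
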